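(* Consider the network of coupled Stuart--Landau systems $$\dot{z}_{j}(t)=(\alpha+i\beta)z_{j}(t)-z_{j}(t)|z_{j}(t)|^{2}+\kappa\sum_{l=1}^{n}A_{jl}\,h\big(z_{l}(t-\tau)-z_{j}(t-\tau)\big),\qquad j=1,\dots,n,\quad z_j\in\mathbb{C},$$ with $\alpha>0$, $\beta>0$ and $h'(0)=1$, under the standing assumptions listed in the context. Let the condition $$\tau\neq\frac{\pi+2M\pi}{2\beta},\qquad M\in\mathbb{N},$$ be fulfilled. Then there is $\tau_0>0$ such that for each $\tau>\tau_0$ there is $\kappa_c=\kappa_c(\tau)$ such that the synchronous periodic solution $z_1(t)=\dots=z_n(t)=\sqrt{\alpha}\,e^{i\beta t}$ is locally exponentially stable (I) for $0<\kappa<\kappa_c(\tau)$, if $\cos(\beta\tau)>0$; or (II) for $-\kappa_c(\tau)<\kappa<0$, if $\cos(\beta\tau)<0$. Moreover, $\kappa_c(\tau)\to0$ as $\tau\to\infty$.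
   Context: $\kappa\in\mathbb{R}$ is the coupling strength and $\tau>0$ is the time delay. Initial conditions are continuous history functions on $[-\tau,0]$, with the maximum norm. Standing assumptions: - $A=(A_{jl})$ is the $n\times n$ adjacency matrix of the network: $A_{jl}=1$ if $j\ne l$ and there is a link from $l$ to $j$, and $A_{jl}=0$ otherwise. - The Laplacian matrix $L=D-A$ is diagonalizable, where $D$ is the diagonal matrix of the degrees, $D_{jj}=\sum_l A_{jl}$. - The coupling function $h:\mathbb{C}\to\mathbb{C}$ (with $\mathbb{C}$ identified with $\mathbb{R}^2$) is bounded and differentiable, with $h(0)=0$; $h'(0)=1$ means that its Jacobian at $0$ is the identity. - The solutions of the network system are uniformly bounded. Local exponential stability of a periodic solution is understood in the orbital sense, i.e. up to the trivial phase shift (the trivial Floquet multiplier $1$).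
   Formalization: The formal theorem also assumes that some node of the network reaches every node along directed links (connectedness); without it the claim fails, e.g. for two nodes with no link, whose phases stay different. *)

(* Defs.v *)
From HB Require Import structures.
From mathcomp Require Import all_boot all_order all_algebra.
From mathcomp Require Import all_classical all_reals all_analysis.
From mathcomp Require Import complex.

Set Implicit Arguments.
Unset Strict Implicit.
Unset Printing Implicit Defensive.

Import Order.TTheory GRing.Theory Num.Theory.
Import numFieldNormedType.Exports.

Local Open Scope classical_set_scope.
Local Open Scope ring_scope.
Local Open Scope complex_scope.

(* The identification of R[i] with the real normed space R * R. Derivatives and
   continuity are taken there, since the only normed module structure that
   R[i] could inherit is the one over itself, which yields complex derivatives. *)
Definition toR2 (R : Type) (z : R[i]) : R * R := (complex.Re z, complex.Im z).

Definition ofR2 (R : Type) (p : R * R) : R[i] := p.1 +i* p.2.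

(* The modulus, as a real number: [`|z|] lives in R[i]. *)
Definition cmod (R : realType) (z : R[i]) : R := complex.Re `|z|.

(* [link l j] means that there is a link from l to j. *)
Definition adjacency (K : pzRingType) (n : nat) (link : rel 'I_n) : 'M[K]_n :=
  \matrix_(j, l) (if (j != l) && link l j then 1 else 0).

Definition degree_mx (K : pzRingType) (n : nat) (A : 'M[K]_n) : 'M[K]_n :=
  diag_mx (\row_j \sum_l A j l).

Definition laplacian (K : pzRingType) (n : nat) (link : rel 'I_n) : 'M[K]_n :=
  degree_mx (adjacency K link) - adjacency K link.

(* Some node reaches every node along directed links; for undirected networks
   this is the usual connectedness. *)
Definition connected_network (n : nat) (link : rel 'I_n) : Prop :=
  exists r : 'I_n, forall j : 'I_n, connect link r j.

Section Coupling.
Variables (R : realType) (h : R[i] -> R[i]).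

Definition real_map : R * R -> R * R := fun p => toR2 (h (ofR2 p)).

Definition coupling_function : Prop :=
  [/\ exists B : R, forall z, cmod (h z) <= B,
      forall p, differentiable real_map p,
      h 0 = 0
    & forall v, 'd real_map (0 : R * R) v = v].

End Coupling.

Section StuartLandauNetwork.
Variables (R : realType) (n : nat) (link : rel 'I_n) (h : R[i] -> R[i]).
Variables (alpha beta kappa tau : R).

Definition vector_field (z : 'I_n -> R -> R[i]) (j : 'I_n) (t : R) : R[i] :=
  (alpha +i* beta) * z j t - z j t * `|z j t| ^+ 2
  + kappa%:C * \sum_(l < n) adjacency _ link j l
                            * h (z l (t - tau) - z j (t - tau)).

(* Only the values on [-tau, +oo) matter; the restriction of z to [-tau, 0] is
   its continuous initial history. The equation at t = 0, with the right
   derivative, follows from the continuity of z and h. *)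
Definition network_solution (z : 'I_n -> R -> R[i]) : Prop :=
  forall j : 'I_n,
    {within `[- tau, +oo[, continuous (fun t : R => toR2 (z j t))} /\
    forall t : R, 0 < t ->
      is_derive t (1 : R) (fun s : R => toR2 (z j s))
                (toR2 (vector_field z j t)).

(* Bounded initial histories have solutions with a common bound. *)
Definition uniformly_bounded_solutions : Prop :=
  forall r : R, exists B : R,
  forall z : 'I_n -> R -> R[i], network_solution z ->
    (forall j s, - tau <= s <= 0 -> cmod (z j s) <= r) ->
  forall j t, 0 <= t -> cmod (z j t) <= B.

(* Histories close, in the maximum norm, to the orbit { p(s + .) } of p give
   solutions converging exponentially to a phase shift of p. The bound with
   every e at least the maximum norm of the perturbation replaces that norm;
   at t = 0 it also controls the distance between the two phases. *)
Definition orbitally_exponentially_stable (p : 'I_n -> R -> R[i]) : Prop :=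
  network_solution p /\
  exists delta C rate : R, [/\ 0 < delta, 0 < C, 0 < rate &
    forall (z : 'I_n -> R -> R[i]) (s e : R),
      network_solution z -> 0 < e <= delta ->
      (forall j u, - tau <= u <= 0 -> cmod (z j u - p j (u + s)) <= e) ->
    exists theta : R, forall j t, 0 <= t ->
      cmod (z j t - p j (t + theta)) <= C * e * expR (- (rate * t))].

End StuartLandauNetwork.

Definition synchronous_orbit (R : realType) (n : nat) (alpha beta : R)
    (j : 'I_n) (t : R) : R[i] :=
  (Num.sqrt alpha)%:C * (cos (beta * t) +i* sin (beta * t)).

(* Main.v *)
Require Import Defs.
From HB Require Import structures.
From mathcomp Require Import all_boot all_order all_algebra.
From mathcomp Require Import all_classical all_reals all_analysis.
From mathcomp Require Import complex.
From mathcomp Require Import ring lra.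
Import Order.TTheory GRing.Theory Num.Theory.
Import numFieldNormedType.Exports.
Local Open Scope classical_set_scope.
Local Open Scope ring_scope.
Local Open Scope complex_scope.

Set Implicit Arguments.
Unset Strict Implicit.
Unset Printing Implicit Defensive.

(* Write [z_j(t) = sqrt alpha e^{i beta (t + s)} (a_j + i b_j)]. On the
   synchronous orbit the radius defects [a_j^2 + b_j^2 - 1] and the differences
   of the [b_j] vanish. Near it the radii relax at rate of order [alpha], while
   to first order in [kappa] [b_j' = - kappa cos (beta tau) (L b)_j]; the delay
   and the coupling to the radii only contribute terms of order [kappa^2], or
   [kappa] times a quantity that can be made small. The nonzero eigenvalues of
   [L] have positive real part, so for weak coupling with
   [kappa cos (beta tau) > 0] the sum of the squared moduli of the nonzero modes
   of [b] is a Lyapunov function, up to a delayed error that is dominated in the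
   manner of Halanay and Razumikhin: at the first time a quantity reaches its
   exponentially decaying barrier, the history still lies below the barrier, and
   the equation forces the derivative
   to point inwards. Then [b_j'] is integrable, and the common limit of the [b_j]
   gives the asymptotic phase. Since [kappa_c] may depend on [tau], it can be
   replaced by [min kappa_c (1 / tau)]. *)

(** * Barriers *)

(** Real induction. At the infimum of the failing times [P] holds by the closedness premise; the
    openness premise then keeps failing times away from their own infimum. *)
Lemma continuation (R : realType) (P : R -> Prop) (t0 : R) :
  P t0 ->
  (forall t, t0 < t -> (forall s, t0 <= s < t -> P s) -> P t) ->
  (forall t, t0 <= t -> P t -> \forall s \near t^'+, P s) ->
  forall t, t0 <= t -> P t.
Proof.
move=> P0 Pclosed Popen t1 t01; apply: contrapT => nPt1.
pose S := [set t | t0 <= t /\ ~ P t].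
have Sn0 : S !=set0 by exists t1.
have Slb : lbound S t0 by move=> t [].
have infS : has_inf S by split=> //; exists t0.
have T0 : t0 <= inf S by exact: lb_le_inf.
have Pbefore s : t0 <= s < inf S -> P s.
  move=> /andP[t0s sT]; apply: contrapT => nPs.
  by have := ge_inf (ex_intro _ t0 Slb) (conj t0s nPs); rewrite leNgt sT.
have PT : P (inf S).
  move: T0; rewrite le_eqVlt => /predU1P[<-//|T0].
  by apply: Pclosed => // s; exact: Pbefore.
have := Popen _ T0 PT; rewrite near_withinE => -[e /= e0 He].
have [s Ss sT] := inf_adherent e0 infS.
have Ts : inf S <= s by apply: ge_inf => //; exists t0.
have [t0s nPs] := Ss; apply: nPs.
move: Ts; rewrite le_eqVlt => /predU1P[<-//|Ts].
by apply: He => //=; rewrite ltr0_norm ?subr_lt0// opprB ltrBlDl.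
Qed.

(** If [D t = 0], the left difference quotients are nonnegative, against a negative limit [D']; if
    [D t > 0], continuity contradicts negativity just before [t]. *)
Lemma negative_touch (R : realType) (D : R -> R) (t0 t D' : R) :
  t0 < t -> is_derive t 1 D D' -> (forall s, t0 <= s < t -> D s < 0) ->
  (D t = 0 -> D' < 0) -> D t < 0.
Proof.
move=> t0t dD Dneg touch; rewrite ltNge; apply/negP; rewrite le_eqVlt.
case/predU1P => [/esym D0|Dpos].
- have D'0 := touch D0.
  have : h^-1 *: (D (h *: 1 + t) - D t) @[h --> 0^'-] --> D'.
    by apply: cvg_dnbhs_at_left; have [Dt <-] := dD; exact: Dt.
  move=> /cvgr_lt/(_ _ D'0) Hq.
  suff : \forall h \near (0:R)^'-, False by move=> /filter_ex[? []].
  near=> h.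
  have h0 : h < 0 by near: h; exact: nbhs_left_lt.
  have : h^-1 *: (D (h *: 1 + t) - D t) < 0 by near: h.
  apply/negP; rewrite -leNgt D0 subr0 /GRing.scale /= mulr1.
  rewrite mulr_le0 ?invr_le0 ?(ltW h0)// ltW// Dneg//.
  rewrite -lerBlDr gtrDr h0 andbT.
  by near: h; apply: nbhs_left_ge; rewrite subr_lt0.
- have cD : D x @[x --> t] --> D t.
    by apply/differentiable_continuous/derivable1_diffP; have [] := dD.
  have {}cD := cvgr_gt _ (cvg_at_left_filter cD) _ Dpos.
  suff : \forall s \near t^'-, False by move=> /filter_ex[? []].
  near=> s.
  have : D s < 0.
    by apply: Dneg; apply/andP; split; near: s;
      [exact: nbhs_left_ge|exact: nbhs_left_lt].
  by apply/negP; rewrite -leNgt; apply/ltW; near: s; exact: cD.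
Unshelve. all: by end_near. Qed.

(** Comparing squares expresses [|f| < |g|] without the absolute value, which is not differentiable
    at 0. *)
Lemma square_barrier (R : realType) (f g : R -> R) (t0 t f' g' : R) :
  t0 < t -> is_derive t 1 f f' -> is_derive t 1 g g' ->
  (forall s, t0 <= s < t -> f s ^+ 2 < g s ^+ 2) ->
  (f t ^+ 2 = g t ^+ 2 -> f t * f' < g t * g') -> f t ^+ 2 < g t ^+ 2.
Proof.
move=> t0t df dg before touch; rewrite -subr_lt0.
apply: (@negative_touch _ (f ^+ 2 - g ^+ 2) t0 t) => // [s /before|/eqP].
  by rewrite -subr_lt0.
rewrite subr_eq0 => /eqP /touch; rewrite /GRing.scale /= !expr1; lra.
Qed.

(** With [E] the tail integral of the bound, [f + E] is nonincreasing and [f - E] is nondecreasing.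
    The supremum of [f - E] lies between them, hence within [E t] of [f t]. *)
Lemma exponential_limit (R : realType) (f : R -> R) (T C rate : R) :
  0 < rate ->
  (forall t, T <= t -> exists2 f', is_derive t 1 f f' &
     `|f'| <= C * expR (- (rate * t))) ->
  exists l, forall t, T <= t -> `|f t - l| <= C / rate * expR (- (rate * t)).
Proof.
move=> rate0 df.
pose E (t : R) := C / rate * expR (- (rate * t)).
have dE (t : R) : is_derive t 1 E (- (C * expR (- (rate * t)))).
  rewrite /E; apply: is_derive_eq.
  rewrite /GRing.scale /=; field; exact: lt0r_neq0.
(* The sign [c] is 1 or -1, which treats [f + E] and [f - E] at once. *)
have mono (c s t : R) : `|c| = 1 -> T <= s -> s <= t ->
    c * f t + E t <= c * f s + E s.
  move=> c1 Ts st.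
  pose g := (fun x => c * f x + E x).
  have dg (x : R) : T <= x -> exists2 g', is_derive x 1 g g' & g' <= 0.
    move=> /df[f' df' lef']; exists (c * f' - C * expR (- (rate * x))).
      by apply: is_derive_eq; rewrite ?addr0.
    rewrite subr_le0 (le_trans (ler_norm _))// normrM c1 mul1r//.
  have Ig x : x \in `]s, t[ -> T <= x.
    by rewrite in_itv /= => /andP[sx _]; rewrite (le_trans Ts)// ltW.
  apply: (@ler0_derive1_le_cc _ g s t) => //.
  - by move=> x /Ig/dg[g' []].
  - by move=> x /Ig/dg[g' [_ <-]]; rewrite derive1E.
  - apply: derivable_within_continuous => x; rewrite in_itv /= => /andP[sx _].
    by have [|g' []] := dg x; rewrite ?(le_trans Ts).
  - by rewrite in_itv /= lexx st.
  - by rewrite in_itv /= lexx st.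
pose S := [set f t - E t | t in [set t | T <= t]].
have ub t : T <= t -> ubound S (f t + E t).
  move=> Tt _ [s /= Ts <-].
  have E0 u : 0 <= C * expR (- (rate * u)) -> 0 <= E u.
    by move=> H; rewrite /E mulrAC divr_ge0// ltW.
  have {}E0 u : T <= u -> 0 <= E u.
    by move=> /df[? _ H]; apply: E0; rewrite (le_trans _ H).
  have [st|ts] := leP s t.
    have := mono (-1) s t; rewrite normrN1 => /(_ erefl Ts st).
    have := E0 _ Tt; lra.
  have := mono 1 t s; rewrite normr1 => /(_ erefl Tt (ltW ts)).
  have := E0 _ Ts; lra.
exists (sup S) => t Tt; rewrite ler_norml -/(E t).
have : f t - E t <= sup S.
  by apply: ub_le_sup; [exists (f T + E T); exact: ub|exists t].
have : sup S <= f t + E t.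
  by apply: ge_sup; [exists (f t - E t); exists t|exact: ub].
lra.
Qed.

Lemma lipschitz_of_derivative (R : realType) (f : R -> R) (a b C : R) :
  a <= b ->
  (forall x, a <= x <= b -> exists2 f', is_derive x 1 f f' & `|f'| <= C) ->
  `|f b - f a| <= C * (b - a).
Proof.
move=> ab df.
have Iab x : x \in `[a, b] -> a <= x <= b by rewrite in_itv.
have [||x /Iab /df[f' [_ <-] le_f'] ->] := @MVT_segment _ f ('D_1 f) a b ab.
- move=> x; rewrite in_itv /= => /andP[ax xb].
  by have [|f' [? _] _] := df x; [rewrite !ltW|exact: derivableP].
- by apply: derivable_within_continuous => x /Iab /df[f' []].
by rewrite normrM (ger0_norm (_ : 0 <= b - a)) ?subr_ge0// ler_wpM2r// subr_ge0.
Qed.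

(** * The Laplacian *)

(** A maximum principle. At a node where the maximum is attained the vanishing sum has nonnegative
    terms, so every node linking to it attains the maximum too. Going back along a path reaches the
    root. The same for [- x] shows that the root value is also the minimum. *)
Lemma laplacian_vanishing_constant (R : realType) (n : nat) (link : rel 'I_n)
    (x : 'I_n -> R) :
  connected_network link ->
  (forall j, \sum_l adjacency R link j l * (x j - x l) = 0) ->
  forall i j, x i = x j.
Proof.
case=> r reach.
have max_at_root (y : 'I_n -> R) :
    (forall j, \sum_l adjacency R link j l * (y j - y l) = 0) ->
    forall j, y j <= y r.
  move=> harm j0; have [m _ maxm] := @arg_maxP _ R _ r xpredT y erefl.
  suff -> : y r = y m by exact: maxm.
  have /connectP[p link_p lastp] := reach m.
  have : y (last r p) = y m by rewrite -lastp.
  elim: p r link_p {lastp reach} => [//|a p IH] r /= /andP[link_ra link_p] ymax.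
  have ya := IH a link_p ymax.
  (* [adjacency] is zero on the diagonal, so a self-link on the path is treated apart. *)
  have [<-//|ar] := eqVneq a r.
  have nonneg l : true -> 0 <= adjacency R link a l * (y a - y l).
    move=> _; rewrite mxE; case: ifP => _; rewrite ?mul0r// mul1r subr_ge0.
    by rewrite ya; exact: maxm.
  have /(_ r erefl)/eqP := psumr_eq0P nonneg (harm a).
  by rewrite mxE ar link_ra /= mul1r ya subr_eq0 => /eqP.
have le_r := max_at_root _; have xmax := le_r x.
move=> harm; have xr j : x j = x r.
  apply/eqP; rewrite eq_le xmax//= -lerN2.
  apply: (le_r (fun j => - x j)) => k.
  rewrite -[RHS]oppr0 -[in RHS](harm k) -sumrN; apply: eq_bigr => l _.
  by ring.
by move=> i j; rewrite !xr.
Qed.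

Lemma laplacian_mulE (K : pzRingType) (n : nat) (link : rel 'I_n)
    (x : 'cV[K]_n) (j : 'I_n) :
  (laplacian K link *m x) j 0 =
  \sum_l adjacency K link j l * (x j 0 - x l 0).
Proof.
rewrite /laplacian /degree_mx mulmxBl mul_diag_mx !mxE mulr_suml -sumrB.
by apply: eq_bigr => l _; rewrite mulrBr.
Qed.

Lemma cmodE (R : realType) (z : R[i]) : `|z| = (cmod z)%:C.
Proof. by rewrite /cmod normc_def. Qed.

(** Gershgorin's argument in the row where the eigenvector has its largest modulus: [d] lies in the
    disc of centre and radius [D], which meets the closed left half-plane only at 0. *)
Lemma laplacian_eigenvalue_Re (R : realType) (n : nat) (link : rel 'I_n)
    (x : 'cV[R[i]]_n) (d : R[i]) :
  laplacian R[i] link *m x = d *: x -> x != 0 -> d != 0 -> 0 < complex.Re d.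
Proof.
move=> Lx x0 d0.
have [i0 xi0] : exists i, x i 0 != 0.
  apply/existsP; apply: contra_neqT x0; rewrite negb_exists => /forallP H.
  by apply/colP => i; rewrite mxE; apply/eqP; have := H i; rewrite negbK.
have [m _ maxm] := @arg_maxP _ R _ i0 xpredT (fun i => cmod (x i 0)) erefl.
have xm_gt0 : 0 < `|x m 0|.
  apply: (@lt_le_trans _ _ `|x i0 0|); first by rewrite normr_gt0.
  by rewrite !cmodE lecR; exact: maxm.
pose D : R := \sum_l adjacency R link m l.
have DE : (D%:C : R[i]) = \sum_l adjacency R[i] link m l.
  rewrite /D rmorph_sum; apply: eq_bigr => l _.
  by rewrite !mxE; case: ifP; rewrite ?rmorph1 ?rmorph0.
have D0 : 0 <= D by apply: sumr_ge0 => l _; rewrite mxE; case: ifP.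
have eqm : (d - D%:C) * x m 0 = - \sum_l adjacency R[i] link m l * x l 0.
  have := congr1 (fun y : 'cV_n => y m 0) Lx; rewrite laplacian_mulE mxE => H.
  rewrite mulrBl -H DE mulr_suml -sumrB -sumrN; apply: eq_bigr => l _.
  by ring.
have : `|d - D%:C| <= D%:C.
  rewrite -(ler_pM2r xm_gt0) -normrM eqm normrN DE mulr_suml.
  apply: le_trans (ler_norm_sum _ _ _) _; apply: ler_sum => l _.
  rewrite mxE; case: ifP => _; rewrite ?mul0r ?normr0// !mul1r.
  by rewrite !cmodE lecR; exact: maxm.
rewrite normc_def lecR -(ler_pXn2r (_ : 0 < 2)%N) ?nnegrE ?sqrtr_ge0//.
rewrite sqr_sqrtr ?addr_ge0 ?sqr_ge0//.
case: d d0 {Lx eqm} => u v; rewrite eq_complex /= negb_and => uv0 le_sq.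
have {}uv0 : 0 < u ^+ 2 + v ^+ 2.
  by case/orP: uv0 => ?; [apply: ltr_pwDl|apply: ltr_wpDl];
    rewrite ?sqr_ge0// exprn_even_gt0.
move: le_sq => /=; rewrite subr0 => le_sq.
(* Membership in the disc reads [u^2 + v^2 <= 2 D u], and the left side is positive. *)
have : 0 < D * u by lra.
by rewrite !ltNge; apply: contra => u0; rewrite mulr_ge0_le0.
Qed.

Lemma cmod_ge0 (R : realType) (z : R[i]) : 0 <= cmod z.
Proof. by rewrite -ler0c -cmodE normr_ge0. Qed.

Lemma cmodM (R : realType) (z w : R[i]) : cmod (z * w) = cmod z * cmod w.
Proof. by rewrite {1}/cmod normrM !cmodE /= mul0r subr0. Qed.

Lemma le_cmod_sum (R : realType) (I : finType) (F : I -> R[i]) :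
  cmod (\sum_i F i) <= \sum_i cmod (F i).
Proof.
rewrite -lecR rmorph_sum -cmodE [leRHS](eq_bigr (fun i => `|F i|))//.
exact: ler_norm_sum.
Qed.

Lemma cmod_real (R : realType) (x : R) : cmod x%:C = `|x|.
Proof. by rewrite /cmod normc_def /= expr0n /= addr0 sqrtr_sqr. Qed.

Lemma cmod_conjc (R : realType) (z : R[i]) : cmod (conjc z) = cmod z.
Proof. by rewrite /cmod normcJ. Qed.

Lemma Re_le_cmod (R : realType) (z : R[i]) : `|complex.Re z| <= cmod z.
Proof. by rewrite -lecR -cmodE normc_ge_Re. Qed.

Lemma Re_mul_conjc (R : realType) (z : R[i]) :
  complex.Re (z * conjc z) = cmod z ^+ 2.
Proof. by rewrite -sqr_normc cmodE -rmorphXn. Qed.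

Lemma Re_sum (R : realType) (I : Type) (r : seq I) (P : pred I)
    (F : I -> R[i]) :
  complex.Re (\sum_(i <- r | P i) F i) = \sum_(i <- r | P i) complex.Re (F i).
Proof. by apply: big_morph => // -[a b] [c d]. Qed.

(** Provides the spectral gap [mu]. The summand 1 keeps the witness defined and positive even if no
    [F i] is positive. *)
Lemma finite_positive_lower_bound (R : realType) (I : finType) (F : I -> R) :
  exists2 m : R, 0 < m & forall i, 0 < F i -> m <= F i.
Proof.
pose s := 1 + \sum_(i | 0 < F i) (F i)^-1.
have s0 : 0 < s.
  by rewrite ltr_pwDl// sumr_ge0// => i /ltW; rewrite invr_ge0.
exists s^-1 => [|i Fi]; first by rewrite invr_gt0.
rewrite -[F i]invrK lef_pV2 ?posrE ?invr_gt0// /s (bigD1 i)//=.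
rewrite addrCA lerDl addr_ge0// sumr_ge0// => j /andP[/ltW].
by rewrite invr_ge0.
Qed.

Definition bilinear_form (R : pzRingType) (n : nat) (S : 'I_n -> 'I_n -> R)
    (x y : 'I_n -> R) : R :=
  \sum_i \sum_j S i j * x i * y j.

Definition laplacian_fun (R : realType) (n : nat) (link : rel 'I_n)
    (x : 'I_n -> R) (j : 'I_n) : R :=
  \sum_l adjacency R link j l * (x j - x l).

(* The form is the sum of the squared moduli of the coordinates of [x] on the
   eigenmodes of the Laplacian whose eigenvalue is not zero. *)
Lemma laplacian_lyapunov_form (R : realType) (n : nat) (link : rel 'I_n) :
  connected_network link -> diagonalizable (laplacian R[i] link) ->
  exists (S : 'I_n -> 'I_n -> R) (mu c : R), [/\ 0 < mu, 0 < c,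
    (forall x y, bilinear_form S x y = bilinear_form S y x) /\
    (forall x, mu * bilinear_form S x x <=
               bilinear_form S x (laplacian_fun link x)),
    (forall x i j M, 0 <= M -> bilinear_form S x x <= M ^+ 2 ->
       `|x i - x j| <= c * M) &
    (forall x e E M, 0 <= M -> bilinear_form S x x <= M ^+ 2 ->
       (forall j, `|e j| <= E) -> `|bilinear_form S x e| <= c * E * M)].
Proof.
move=> connected [P Punit /diagonalizable_forPex[d /(simmxP Punit) PL]].
(* The rows of [P] are left eigenvectors and the columns of [Q] right eigenvectors of the Laplacian;
   [y x] lists the coordinates of [x] on the columns of [Q]. *)
pose Q := invmx P.
pose y (x : 'I_n -> R) m := \sum_i P m i * (x i)%:C.
pose S i j := \sum_(m | d 0 m != 0) complex.Re (P m i * conjc (P m j)).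
have yyE x z m : complex.Re (y x m * conjc (y z m)) =
    \sum_i \sum_j complex.Re (P m i * conjc (P m j)) * x i * z j.
  rewrite /y rmorph_sum mulr_suml Re_sum; apply: eq_bigr => i _.
  rewrite mulr_sumr Re_sum; apply: eq_bigr => j _.
  by case: (P m i) (P m j) => a b [a' b'] /=; ring.
have BE x z : bilinear_form S x z =
    \sum_(m | d 0 m != 0) complex.Re (y x m * conjc (y z m)).
  rewrite (eq_bigr _ (fun m _ => yyE x z m)) exchange_big.
  apply: eq_bigr => i _; rewrite exchange_big; apply: eq_bigr => j _.
  by rewrite !mulr_suml.
have yL x m : y (laplacian_fun link x) m = d 0 m * y x m.
  pose X : 'cV[R[i]]_n := \col_i (x i)%:C.
  have := congr1 (fun M : 'M[R[i]]_n => (M *m X) m 0) PL.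
  rewrite -!mulmxA mul_diag_mx.
  rewrite [RHS]mxE [LHS]mxE => H.
  rewrite (_ : y x m = (P *m X) m 0); last first.
    by rewrite mxE; apply: eq_bigr => i _; rewrite mxE.
  rewrite -H; apply: eq_bigr => i _; congr (_ * _).
  rewrite laplacian_mulE rmorph_sum; apply: eq_bigr => l _.
  by rewrite !mxE rmorphM rmorphB; case: ifP => _; rewrite ?rmorph0 ?rmorph1.
have LQ m : laplacian _ link *m col m Q = d 0 m *: col m Q.
  apply/colP => i; rewrite [LHS]mxE [RHS]mxE [col m Q i 0]mxE mulrC.
  have LQ : laplacian _ link *m Q = Q *m diag_mx d.
    by rewrite -[laplacian _ _](mulKmx Punit) PL -!mulmxA mulmxV// mulmx1.
  have := congr1 (fun M : 'M[R[i]]_n => M i m) LQ.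
  rewrite mul_mx_diag [LHS]mxE [RHS]mxE => <-.
  by apply: eq_bigr => k _; rewrite [col m Q k 0]mxE.
have Qcol0 m : col m Q != 0.
  apply/negP => /eqP Q0; have : P *m Q = 1%:M by rewrite mulmxV.
  move=> /(congr1 (fun M : 'M[R[i]]_n => M m m))/eqP; rewrite !mxE eqxx.
  rewrite big1 => [|k _]; first by rewrite eq_sym oner_eq0.
  by have /colP/(_ k) := Q0; rewrite !mxE => ->; rewrite mulr0.
have Red m : d 0 m != 0 -> 0 < complex.Re (d 0 m).
  exact: (laplacian_eigenvalue_Re (LQ m)).
(* The real and imaginary parts of a null vector are separately annihilated by the real Laplacian,
   hence constant. Null modes therefore do not contribute to [x i - x j], although [S] ignores
   them. *)
have Qconst m i j : d 0 m = 0 -> Q i m = Q j m.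
  move=> dm; have L0 := LQ m; rewrite dm scale0r in L0.
  have partial (f : R[i] -> R) :
      f 0 = 0 -> {morph f : u v / u + v} -> {morph f : u v / u - v} ->
      f (Q i m) = f (Q j m).
    move=> f0 fD fB.
    apply: (laplacian_vanishing_constant (x := fun i => f (Q i m)) connected).
    move=> k; have : f ((laplacian _ link *m col m Q) k 0) = 0.
      by rewrite L0 mxE.
    rewrite laplacian_mulE (big_morph f fD f0) => fL; rewrite -[RHS]fL.
    apply: eq_bigr => l _; rewrite !mxE -fB.
    by case: ifP => _; rewrite ?mul0r ?f0// !mul1r.
  apply/eqP; rewrite eq_complex; apply/andP; split; apply/eqP.
    by apply: (partial (@complex.Re R)) => // -[u v] [u' v'].
  by apply: (partial (@complex.Im R)) => // -[u v] [u' v'].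
have xE x i : (x i)%:C = \sum_m Q i m * y x m.
  pose X : 'cV[R[i]]_n := \col_i (x i)%:C.
  have := congr1 (fun M : 'cV_n => M i 0) (mulKmx Punit X).
  rewrite [RHS]mxE => <-; rewrite mxE; apply: eq_bigr => m _; congr (_ * _).
  by rewrite mxE; apply: eq_bigr => k _; rewrite mxE.
have y_le x M m : 0 <= M -> bilinear_form S x x <= M ^+ 2 -> d 0 m != 0 ->
    cmod (y x m) <= M.
  move=> M0; rewrite BE => BM dm.
  rewrite -(ler_pXn2r (_ : 0 < 2)%N) ?nnegrE ?cmod_ge0//.
  apply: le_trans BM; rewrite (bigD1 m)//= Re_mul_conjc lerDl.
  by apply: sumr_ge0 => k _; rewrite Re_mul_conjc sqr_ge0.
have [mu mu0 le_mu] := finite_positive_lower_bound (fun m => complex.Re (d 0 m)).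
(* [c1] controls the passage from coordinates to differences of entries, [c2] that from entries to
   coordinates. One constant, [1 + c1 + c2], serves for both and is positive. *)
pose c1 := \sum_m \sum_i \sum_j cmod (Q i m - Q j m).
pose c2 := \sum_m \sum_i cmod (P m i).
have c1_0 : 0 <= c1.
  by do 3!apply: sumr_ge0 => ? _; exact: cmod_ge0.
have c2_0 : 0 <= c2.
  by do 2!apply: sumr_ge0 => ? _; exact: cmod_ge0.
exists S, mu, (1 + c1 + c2); split => //.
- by rewrite -addrA ltr_pwDl ?addr_ge0.
- split=> [x z|x].
    rewrite !BE; apply: eq_bigr => m _.
    by case: (y x m) (y z m) => [u v] [u' v'] /=; ring.
  rewrite !BE mulr_sumr; apply: ler_sum => m dm; rewrite yL Re_mul_conjc.
  have -> : complex.Re (y x m * conjc (d 0 m * y x m)) =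
      complex.Re (d 0 m) * cmod (y x m) ^+ 2.
    rewrite -Re_mul_conjc.
    by case: (y x m) (d 0 m) => [u v] [u' v'] /=; ring.
  by rewrite ler_wpM2r ?sqr_ge0// le_mu// Red.
- move=> x i j M M0 BM.
  rewrite -cmod_real rmorphB /= !xE -sumrB.
  apply: le_trans (le_cmod_sum _) _.
  apply: (@le_trans _ _ (c1 * M)); last first.
    by rewrite ler_wpM2r// addrAC ler_wpDl// addr_ge0.
  rewrite mulr_suml; apply: ler_sum => m _.
  rewrite -mulrBl; have [/(Qconst m i j) ->|dm] := eqVneq (d 0 m) 0.
    rewrite subrr mul0r cmod_real normr0 mulr_ge0//.
    by do 2!apply: sumr_ge0 => ? _; exact: cmod_ge0.
  rewrite cmodM ler_pM ?cmod_ge0// ?y_le//.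
  rewrite (bigD1 i)//= (bigD1 j)//= -addrA lerDl addr_ge0//.
    by apply: sumr_ge0 => ? _; exact: cmod_ge0.
  by do 2!apply: sumr_ge0 => ? _; exact: cmod_ge0.
- move=> x e E M M0 BM eE.
  have E0 : 0 <= E.
    by have [r _] := connected; rewrite (le_trans _ (eE r)).
  apply: (@le_trans _ _ (c2 * E * M)); last first.
    by rewrite !ler_wpM2r// ler_wpDl// addr_ge0.
  rewrite BE -mulrA mulr_suml; apply: le_trans (ler_norm_sum _ _ _) _.
  rewrite [leRHS](bigID (fun m => d 0 m != 0)) /= -[leLHS]addr0.
  rewrite lerD//; last first.
    apply: sumr_ge0 => m _; rewrite !mulr_ge0// sumr_ge0// => ? _.
    exact: cmod_ge0.
  apply: ler_sum => m dm.
  apply: (le_trans (Re_le_cmod _)); rewrite cmodM cmod_conjc mulrC mulrA.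
  rewrite ler_pM ?cmod_ge0//; last exact: y_le.
  rewrite /y; apply: le_trans (le_cmod_sum _) _.
  rewrite mulr_suml; apply: ler_sum => i _.
  by rewrite cmodM cmod_real ler_wpM2l ?cmod_ge0.
Qed.

(** * The rotating frame *)

(** The weak inequality needs no sign condition at a touching time. It places the time [t] itself
    inside the closed region in which that sign condition is then checked. *)
Lemma left_limit_le0 (R : realType) (D : R -> R) (t0 t D' : R) :
  t0 < t -> is_derive t 1 D D' -> (forall s, t0 <= s < t -> D s < 0) ->
  D t <= 0.
Proof.
move=> t0t dD Dneg; have [D0|D0] := eqVneq (D t) 0; first by rewrite D0.
by apply/ltW/(negative_touch t0t dD Dneg) => /eqP; rewrite (negPf D0).
Qed.

Lemma square_barrier_le (R : realType) (f g : R -> R) (t0 t f' g' : R) :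
  t0 < t -> is_derive t 1 f f' -> is_derive t 1 g g' ->
  (forall s, t0 <= s < t -> f s ^+ 2 < g s ^+ 2) -> f t ^+ 2 <= g t ^+ 2.
Proof.
move=> t0t df dg before; rewrite -subr_le0.
apply: (@left_limit_le0 _ (f ^+ 2 - g ^+ 2) t0 t) => // s /before.
by rewrite -subr_lt0.
Qed.

Lemma derive_right_continuous (R : realType) (f : R -> R) (t f' : R) :
  is_derive t 1 f f' -> f x @[x --> t^'+] --> f t.
Proof.
move=> [df _]; apply: cvg_at_right_filter.
exact/differentiable_continuous/derivable1_diffP.
Qed.

Lemma near_right_square_lt (R : realType) (f g : R -> R) (t : R) :
  f x @[x --> t^'+] --> f t -> g x @[x --> t^'+] --> g t ->
  f t ^+ 2 < g t ^+ 2 -> \forall s \near t^'+, f s ^+ 2 < g s ^+ 2.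
Proof.
move=> fc gc; rewrite -subr_lt0 => fg.
have cD : f x * f x - g x * g x @[x --> t^'+] --> f t * f t - g t * g t.
  by apply: cvgB; apply: cvgM.
have := cvgr_lt _ cD 0; rewrite -!expr2 => /(_ _ fg); apply: filterS => s.
by rewrite -!expr2 subr_lt0.
Qed.

Lemma norm_mul_le (R : numDomainType) (x y X Y : R) :
  `|x| <= X -> `|y| <= Y -> `|x * y| <= X * Y.
Proof. by move=> xX yY; rewrite normrM ler_pM. Qed.

Lemma square_le_norm (R : realDomainType) (x y : R) :
  0 <= y -> x ^+ 2 <= y ^+ 2 -> `|x| <= y.
Proof.
by move=> y0; rewrite -[x ^+ 2]real_normK ?num_real// ler_pXn2r// ?nnegrE.
Qed.

Lemma norm_lt_square (R : realDomainType) (x y : R) :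
  `|x| < y -> x ^+ 2 < y ^+ 2.
Proof.
move=> xy; rewrite -[x ^+ 2]real_normK ?num_real// ltr_pXn2r// ?nnegrE//.
exact: le_trans (ltW xy).
Qed.

Section RotatingFrame.
Variables (R : realType) (n : nat) (link : rel 'I_n).
Variables (alpha kappa tau c sg eps eta0 : R).
Variables (a b : 'I_n -> R -> R) (gr gi : 'I_n -> 'I_n -> R -> R).

Definition coupling_sum (f : 'I_n -> 'I_n -> R -> R) j t : R :=
  \sum_l adjacency R link j l * f j l t.

Definition a_rate j t : R :=
  alpha * a j t * (1 - a j t ^+ 2 - b j t ^+ 2) + kappa * coupling_sum gr j t.

Definition b_rate j t : R :=
  alpha * b j t * (1 - a j t ^+ 2 - b j t ^+ 2) + kappa * coupling_sum gi j t.

(* [gr j l t] and [gi j l t] stand for the components, in the frame at time [t],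
   of [h (z_l - z_j)] at time [t - tau]. In between the frame turns by
   [beta tau]; [c] and [sg] are the cosine and the sine of that angle. *)
Definition frame_solution : Prop := forall (j : 'I_n) (t : R), 0 < t ->
  is_derive t 1 (a j) (a_rate j t) /\ is_derive t 1 (b j) (b_rate j t).

Definition coupling_estimate : Prop := forall (j l : 'I_n) (t M : R),
  0 < t -> 0 <= M <= eta0 ->
  `|a l (t - tau) - a j (t - tau)| <= M ->
  `|b l (t - tau) - b j (t - tau)| <= M ->
  `|gr j l t - (c * (a l (t - tau) - a j (t - tau))
                + sg * (b l (t - tau) - b j (t - tau)))| <= eps * M /\
  `|gi j l t - (c * (b l (t - tau) - b j (t - tau))
                - sg * (a l (t - tau) - a j (t - tau)))| <= eps * M.

Hypotheses (c1 : `|c| <= 1) (sg1 : `|sg| <= 1) (eps1 : eps <= 1).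
Hypotheses (alpha0 : 0 < alpha) (tau0 : 0 < tau).
Hypotheses (sol : frame_solution) (est : coupling_estimate).

Lemma adjacency_sum_le (f : 'I_n -> R) (F : R) j :
  (forall l, `|f l| <= F) ->
  `|\sum_l adjacency R link j l * f l| <= n%:R * F.
Proof.
move=> fF; have F0 : 0 <= F by exact: le_trans (fF j).
apply: le_trans (ler_norm_sum _ _ _) _.
rewrite -[n in n%:R]card_ord mulr_natl -sumr_const; apply: ler_sum => l _.
by rewrite mxE; case: ifP => _; rewrite ?mul0r ?normr0// mul1r.
Qed.

(** Each of the three contributions, with factors [c], [sg] and [eps], is at most [M]. *)
Lemma coupling_sum_le j t M : 0 < t -> 0 <= M <= eta0 ->
  (forall i l, `|a l (t - tau) - a i (t - tau)| <= M) ->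
  (forall i l, `|b l (t - tau) - b i (t - tau)| <= M) ->
  `|coupling_sum gr j t| <= n%:R * (3 * M) /\
  `|coupling_sum gi j t| <= n%:R * (3 * M).
Proof.
move=> t0 M0 da db; have M_ge0 : 0 <= M by case/andP: M0.
have epsM : eps * M <= M by rewrite ler_piMl.
split; apply: adjacency_sum_le => l;
  have [] := est t0 M0 (da j l) (db j l);
  have := norm_mul_le c1 (da j l); have := norm_mul_le c1 (db j l);
  have := norm_mul_le sg1 (da j l); have := norm_mul_le sg1 (db j l);
  rewrite !ler_norml; lra.
Qed.

(** On [[0, tau]] the delayed terms see only the history, so an exponential barrier bounds the
    growth. Together with the history this covers a window of length [2 * tau], which the
    contraction argument needs: it bounds [b_j'] on [[t - tau, t]], and that derivative is itself
    delayed by [tau]. *)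
Lemma growth_from_history (e : R) :
  let Lambda := 4 * alpha + 6 * n%:R * `|kappa| + 1 in
  let G (t : R) := 2 * e * expR (Lambda * t) in
  0 < e -> 2 * e <= eta0 -> G tau <= 4^-1 ->
  (forall j, a j x @[x --> 0^'+] --> a j 0) ->
  (forall j, b j x @[x --> 0^'+] --> b j 0) ->
  (forall (j : 'I_n) (t : R), - tau <= t <= 0 ->
     `|a j t - 1| <= e /\ `|b j t| <= e) ->
  forall (j : 'I_n) (t : R), - tau <= t <= tau ->
    `|a j t - 1| <= G tau /\ `|b j t| <= G tau.
Proof.
move=> Lambda G e0 e_eta G4 ac bc hist.
have Lambda0 : 0 < Lambda.
  by rewrite ltr_wpDl// addr_ge0// ?mulr_ge0// ltW.
have dG (t : R) : is_derive t 1 G (Lambda * G t).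
  rewrite /G; apply: is_derive_eq; rewrite /GRing.scale /=; lra.
have G_ge (t : R) : 0 <= t -> 2 * e <= G t.
  move=> t0; rewrite /G ler_pMr ?mulr_gt0// -expR0 ler_expR.
  by rewrite mulr_ge0// ltW.
have G_mono (s t : R) : s <= t -> G s <= G t.
  by move=> st; rewrite /G ler_pM2l ?mulr_gt0// ler_expR ler_pM2l.
have G0 (t : R) : 0 < G t by rewrite /G !mulr_gt0// expR_gt0.
have main (t : R) : 0 <= t -> t <= tau -> forall j,
    (a j t - 1) ^+ 2 < G t ^+ 2 /\ b j t ^+ 2 < G t ^+ 2.
  move: t; apply: continuation.
  - move=> _ j; have [|aj bj] := hist j 0; first by rewrite oppr_le0 lexx ltW.
    have := G_ge 0 (lexx _) => G2.
    by split; apply: norm_lt_square; lra.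
  - move=> t t0 before tt j.
    have before_j s : 0 <= s < t ->
        (a j s - 1) ^+ 2 < G s ^+ 2 /\ b j s ^+ 2 < G s ^+ 2.
      move=> s0t; apply: before => //.
      by case/andP: s0t => _ /ltW/le_trans; apply.
    have [da db] := sol j t0.
    have da1 : is_derive t 1 (fun x => a j x - 1) (a_rate j t).
      by apply: is_derive_eq; rewrite ?subr0.
    have a_le : `|a j t - 1| <= G t.
      apply: square_le_norm; first exact: ltW.
      by apply: (square_barrier_le t0 da1 (dG t)) => s /before_j[].
    have b_le : `|b j t| <= G t.
      apply: square_le_norm; first exact: ltW.
      by apply: (square_barrier_le t0 db (dG t)) => s /before_j[].
    have hist_diff i l : `|a l (t - tau) - a i (t - tau)| <= 2 * e /\
        `|b l (t - tau) - b i (t - tau)| <= 2 * e.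
      have I : - tau <= t - tau <= 0 by lra.
      have [] := hist i _ I; have [] := hist l _ I.
      rewrite !ler_norml; lra.
    have e2 : 0 <= 2 * e <= eta0 by rewrite e_eta mulr_ge0// ltW.
    have [Hr Hi] := coupling_sum_le j t0 e2
      (fun i l => (hist_diff i l).1) (fun i l => (hist_diff i l).2).
    have Gt4 : G t <= 4^-1 by rewrite (le_trans (G_mono _ _ tt)).
    have := G_ge t (ltW t0) => G2e.
    have kH H : `|H| <= n%:R * (3 * (2 * e)) ->
        `|kappa * H| <= 3 * n%:R * `|kappa| * G t.
      move=> HH; rewrite normrM mulrC -mulrA [_ * G t]mulrC mulrA ler_wpM2r//.
      apply: (le_trans HH); rewrite mulrA [3 * _]mulrC ler_wpM2l ?mulr_ge0//.
    (* Expanding around [a = 1] gives [2 G + 2 G^2], and [G <= 1/4]. *)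
    have r_le : `|1 - a j t ^+ 2 - b j t ^+ 2| <= 5 / 2 * G t.
      have := norm_mul_le a_le a_le; have := norm_mul_le b_le b_le.
      have : G t * G t <= G t * 4^-1 by rewrite ler_wpM2l// ltW.
      move: a_le; rewrite !ler_norml; lra.
    have al : `|alpha| <= alpha by rewrite gtr0_norm.
    have GG : 0 < G t * G t by rewrite mulr_gt0.
    have aGG : 0 < alpha * (G t * G t) by rewrite mulr_gt0.
    have nkGG : 0 <= n%:R * `|kappa| * (G t * G t) by rewrite !mulr_ge0// ltW.
    split.
      (* The reaction term is at most [(5/4) (5/2) alpha G < 4 alpha G] and the coupling at most
         [3 n |kappa| G]; [Lambda] exceeds the sum of the two rates. *)
      apply: (square_barrier t0 da1 (dG t)) => [s /before_j[]//|_].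
      have a_le2 : `|a j t| <= 5 / 4 by move: a_le; rewrite !ler_norml; lra.
      have := norm_mul_le al (norm_mul_le (norm_mul_le a_le a_le2) r_le).
      have := norm_mul_le a_le (kH _ Hr).
      rewrite /a_rate /Lambda !ler_norml; lra.
    apply: (square_barrier t0 db (dG t)) => [s /before_j[]//|_].
    have r_le1 : `|1 - a j t ^+ 2 - b j t ^+ 2| <= 1.
      by rewrite (le_trans r_le)//; lra.
    have := norm_mul_le al (norm_mul_le (norm_mul_le b_le b_le) r_le1).
    have := norm_mul_le b_le (kH _ Hi).
    rewrite /b_rate /Lambda !ler_norml; lra.
  - move=> t t0 Pt.
    (* To the right of [tau] the claim is vacuous. *)
    have [tt|tt] := leP tau t.
      near=> s => st; suff : t < s by rewrite ltNge (le_trans st).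
      by near: s; exact: nbhs_right_gt.
    (* The equations hold only for positive times, so right continuity at 0 comes from the
       assumptions on the history. *)
    have right_cont (f : 'I_n -> R -> R) f' :
        (forall j, f j x @[x --> 0^'+] --> f j 0) ->
        (forall (j : 'I_n) (t : R), 0 < t -> is_derive t 1 (f j) (f' j t)) ->
        forall j, f j x @[x --> t^'+] --> f j t.
      move=> f0 df j; move: t0; rewrite le_eqVlt => /predU1P[<-//|t0].
      exact: derive_right_continuous (df j t t0).
    have act := right_cont a a_rate ac (fun j t t0 => (sol j t0).1).
    have bct := right_cont b b_rate bc (fun j t t0 => (sol j t0).2).
    have Gct : G x @[x --> t^'+] --> G t := derive_right_continuous (dG t).
    have : forall j, \forall s \near t^'+,
        (a j s - 1) ^+ 2 < G s ^+ 2 /\ b j s ^+ 2 < G s ^+ 2.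
      move=> j; have [Pa Pb] := Pt (ltW tt) j; apply: filterI.
        apply: (near_right_square_lt _ Gct) => //.
        by apply: cvgB => //; exact: cvg_cst.
      exact: near_right_square_lt.
    by move/filter_forall; apply: filterS => s Hs _.
move=> j t /andP[t_ge t_le]; have [t0|t0] := leP 0 t.
  have [aj bj] := main t t0 t_le j.
  by split; apply: le_trans (G_mono _ _ t_le); apply: square_le_norm;
    rewrite ltW.
have [|aj bj] := hist j t; first by rewrite t_ge ltW.
have := G_ge _ (ltW tau0) => G2e.
by split; [move: aj|move: bj] => /le_trans; apply; lra.
Unshelve. all: by end_near. Qed.

End RotatingFrame.

(** * Contraction to the synchronous orbit *)

Lemma bilinear_form_combine (R : comPzRingType) (n : nat)
    (S : 'I_n -> 'I_n -> R) (x y z : 'I_n -> R) (k : R) :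
  bilinear_form S x (fun j => k * y j + z j) =
  k * bilinear_form S x y + bilinear_form S x z.
Proof.
rewrite /bilinear_form mulr_sumr -big_split; apply: eq_bigr => i _ /=.
rewrite mulr_sumr -big_split; apply: eq_bigr => j _ /=; ring.
Qed.

Lemma is_derive_quadratic_form (R : realType) (n : nat) (S : 'I_n -> 'I_n -> R)
    (x : 'I_n -> R -> R) (x' : 'I_n -> R) (t : R) :
  (forall i, is_derive t 1 (x i) (x' i)) ->
  is_derive t 1 (fun s => bilinear_form S (x^~ s) (x^~ s))
    (bilinear_form S x' (x^~ t) + bilinear_form S (x^~ t) x').
Proof.
move=> dx.
(* Written as a sum of products of functions, the form has a derivative that instance search can
   find. *)
have -> : (fun s => bilinear_form S (x^~ s) (x^~ s)) =
    \sum_i \sum_j (S i j \*: x i * x j).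
  apply/funext => s; rewrite fct_sumE; apply: eq_bigr => i _.
  by rewrite fct_sumE.
apply: is_derive_eq.
rewrite /bilinear_form -big_split; apply: eq_bigr => i _ /=.
rewrite -big_split; apply: eq_bigr => j _ /=.
rewrite /GRing.scale /=; ring.
Qed.

Section Contraction.
Variables (R : realType) (n : nat) (link : rel 'I_n).
Variables (alpha kappa tau c sg eps eta0 : R).
Variables (a b : 'I_n -> R -> R) (gr gi : 'I_n -> 'I_n -> R -> R).
Variables (S : 'I_n -> 'I_n -> R) (mu cS q eta rate K B0 : R).

Let ak : R := `|kappa|.
Let C1 : R := 3 * n%:R * cS.
Let m (t : R) := K * expR (- (rate * t)).
Let V (t : R) := bilinear_form S (b^~ t) (b^~ t).

(** Unlike [a - 1], this vanishes on the whole orbit, whatever the phase. *)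
Definition radius_defect (j : 'I_n) (t : R) : R := a j t ^+ 2 + b j t ^+ 2 - 1.

(** Only the transversal quantities [V] and [radius_defect] decay; the phase may converge to a
    nonzero value, so [b] has a constant bound. The coarse bound on [a - 1] selects the branch
    [a > 0], which the radius does not determine. The factor [q] weighs radii against phase
    differences. *)
Definition tube (t : R) : Prop :=
  V t <= m t ^+ 2 /\
  forall j, [/\ `|radius_defect j t| <= q * m t, `|b j t| <= eta &
                `|a j t - 1| <= 2^-1].

Hypotheses (n0 : (0 < n)%N) (kappa0 : kappa != 0).
Hypotheses (c1 : `|c| <= 1) (sg1 : `|sg| <= 1).
Hypotheses (eps0 : 0 < eps) (eps1 : eps <= 1).
Hypotheses (alpha0 : 0 < alpha) (tau0 : 0 < tau).
Hypotheses (sol : frame_solution link alpha kappa a b gr gi).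
Hypotheses (est : coupling_estimate tau c sg eps eta0 a b gr gi).
Hypotheses (mu0 : 0 < mu) (cS0 : 0 < cS).
Hypothesis S_sym : forall x y, bilinear_form S x y = bilinear_form S y x.
Hypothesis S_dissipative : forall x,
  mu * bilinear_form S x x <= bilinear_form S x (laplacian_fun link x).
Hypothesis S_diff : forall (x : 'I_n -> R) (i j : 'I_n) (M : R),
  0 <= M -> bilinear_form S x x <= M ^+ 2 ->
  `|x i - x j| <= cS * M.
Hypothesis S_bound : forall (x e : 'I_n -> R) (E M : R),
  0 <= M -> bilinear_form S x x <= M ^+ 2 ->
  (forall j, `|e j| <= E) -> `|bilinear_form S x e| <= cS * E * M.
Hypotheses (q0 : 0 < q) (q_cS : 4 * q <= cS).
Hypotheses (eta_gt0 : 0 < eta) (eta4 : eta <= 4^-1) (eta_q : cS * eta <= q).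
Hypothesis eta_kappa : alpha * eta * q <= ak * C1.
Hypotheses (rate0 : 0 < rate) (rate_tau : expR (rate * (2 * tau)) <= 2).
(* The error terms come, in this order, from the feedback of the radii, the
   remainder of [h], the radii inside the coupling, and the replacement of
   [b (t - tau)] by [b t]. *)
Hypothesis rate_V :
  cS * (alpha * eta * q + ak * n%:R * (2 * eps * cS + 8 * q + 8 * ak * C1 * tau))
  + rate < kappa * c * mu.
Hypothesis rate_rho : 7 * ak * C1 + rate * q < 3 / 2 * alpha * q.
Hypotheses (K0 : 0 < K) (K_eta0 : cS * (2 * K) <= eta0).
Hypothesis K_q : q * (2 * K) <= 4^-1.
(* An increasing barrier for [`|b j t|]: its slope [5 * ak * C1 * m t] exceeds
   the bound [4 * ak * C1 * m t] on [`|b_rate j t|]. *)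
Let B (t : R) := B0 - 5 * ak * C1 / rate * m t.
Hypotheses (B_tau : 0 < B tau) (B_eta : B0 <= eta).
Hypothesis tube_start : forall t : R, - tau <= t <= tau -> tube t.
Hypothesis strict_start : V tau < m tau ^+ 2 /\
  forall j, [/\ radius_defect j tau ^+ 2 < (q * m tau) ^+ 2,
    b j tau ^+ 2 < B tau ^+ 2 & (a j tau - 1) ^+ 2 < 2^-1 ^+ 2].

Let m_gt0 (t : R) : 0 < m t.
Proof. by rewrite mulr_gt0// expR_gt0. Qed.

Let m_mono (s t : R) : s <= t -> m t <= m s.
Proof. by move=> st; rewrite /m ler_pM2l// ler_expR lerN2 ler_pM2l. Qed.

(** The rate is so small that the barrier at most doubles when looking back by [2 * tau]. This lets
    delayed quantities be bounded by the present value of [m]. *)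
Let m_window (s t : R) : t - 2 * tau <= s -> m s <= 2 * m t.
Proof.
move=> st; rewrite /m mulrCA ler_pM2l//.
have -> : - (rate * s) = - (rate * t) + rate * (t - s) by ring.
rewrite expRD mulrC ler_pM2r ?expR_gt0//; apply: le_trans rate_tau.
by rewrite ler_expR ler_pM2l//; move: st; lra.
Qed.

Let m_start (t : R) : - tau <= t -> m t <= 2 * K.
Proof.
move=> t_ge; have : m t <= 2 * m 0 by apply: m_window; move: tau0; lra.
by rewrite /m mulr0 oppr0 expR0 mulr1.
Qed.

Let m_le_K (t : R) : 0 <= t -> m t <= K.
Proof. by move=> /m_mono; rewrite {2}/m mulr0 oppr0 expR0 mulr1. Qed.

Let dm (t : R) : is_derive t 1 m (- (rate * m t)).
Proof. by rewrite /m; apply: is_derive_eq; rewrite /GRing.scale /=; lra. Qed.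

Let C1_gt0 : 0 < C1.
Proof. by rewrite /C1 !mulr_gt0// ltr0n. Qed.

Let ak_gt0 : 0 < ak.
Proof. by rewrite normr_gt0. Qed.

(** The differences of [a] come from those of the squares, since [a l t + a i t >= 1]. The radii
    contribute [2 q m], and [eta_q] bounds the contribution of the phases by another [2 q m]. *)
Lemma tube_diff (t : R) : tube t -> forall i l,
  `|b l t - b i t| <= cS * m t /\ `|a l t - a i t| <= 4 * q * m t.
Proof.
move=> [Vt Tt] i l.
have db : `|b l t - b i t| <= cS * m t by exact: (S_diff _ _ (ltW (m_gt0 t)) Vt).
split=> //.
have [ri bi ai] := Tt i; have [rl bl al] := Tt l.
have sum_ge1 : 1 <= a l t + a i t.
  by move: ai al; rewrite !ler_norml; lra.
have sum_b : `|b l t + b i t| <= 2 * eta.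
  by move: bi bl; rewrite !ler_norml; lra.
apply: (@le_trans _ _ `|(a l t - a i t) * (a l t + a i t)|).
  by rewrite normrM ler_peMr// (le_trans sum_ge1)// ler_norm.
have -> : (a l t - a i t) * (a l t + a i t) =
    radius_defect l t - radius_defect i t - (b l t - b i t) * (b l t + b i t).
  by rewrite /radius_defect; ring.
have := norm_mul_le db sum_b.
have : m t * (cS * eta) <= m t * q by rewrite ler_pM2l.
move: ri rl; rewrite !ler_norml; lra.
Qed.

Lemma coupling_in_tube (t M : R) : 0 < t -> tube (t - tau) ->
  m (t - tau) <= M -> cS * M <= eta0 ->
  forall j, `|coupling_sum link gr j t| <= C1 * M /\
            `|coupling_sum link gi j t| <= C1 * M.
Proof.
move=> t0 T mM Meta j.
have M0 : 0 < M by exact: lt_le_trans (m_gt0 _) mM.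
have cM : 0 <= cS * M <= eta0 by rewrite Meta mulr_ge0// ltW.
have cmM : cS * m (t - tau) <= cS * M by rewrite ler_pM2l.
have qmM : 4 * q * m (t - tau) <= cS * M.
  by apply: le_trans cmM; rewrite ler_pM2r.
have [] := coupling_sum_le link c1 sg1 eps1 est j t0 cM.
- by move=> i l; apply: le_trans qmM; have [] := tube_diff T i l.
- by move=> i l; apply: le_trans cmM; have [] := tube_diff T i l.
by rewrite /C1 => Hr Hi; split; [apply: le_trans Hr _|apply: le_trans Hi _]; lra.
Qed.

(** By [eta_kappa] the feedback of the radii is no larger than the bound on the coupling, so the
    phases move at a speed of order [kappa] times the barrier. *)
Lemma b_rate_in_tube (t M : R) : 0 < t -> tube t -> tube (t - tau) ->
  m t <= M -> m (t - tau) <= M -> cS * M <= eta0 ->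
  forall j, `|b_rate link alpha kappa a b gi j t| <= 2 * ak * C1 * M.
Proof.
move=> t0 T Td mM mdM Meta j.
have [_ Hi] := coupling_in_tube t0 Td mdM Meta j.
have [_ /(_ j)[rj bj _]] := T.
have al : `|alpha| <= alpha by rewrite gtr0_norm.
have rM : `|radius_defect j t| <= q * M by apply: le_trans rj _; rewrite ler_pM2l.
have M0 : 0 < M by exact: lt_le_trans (m_gt0 _) mM.
have := norm_mul_le (norm_mul_le al bj) rM.
have := norm_mul_le (lexx `|kappa|) Hi.
have : M * (alpha * eta * q) <= M * (ak * C1) by rewrite ler_pM2l.
have -> : b_rate link alpha kappa a b gi j t =
    - (alpha * b j t * radius_defect j t) + kappa * coupling_sum link gi j t.
  by rewrite /b_rate /radius_defect; ring.
rewrite !ler_norml /ak; lra.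
Qed.

(** The strict, hence open, counterpart of [tube], with squares in place of absolute values and the
    moving barrier [B] in place of [eta]. *)
Definition inner_tube (t : R) : Prop :=
  V t < m t ^+ 2 /\
  forall j, [/\ radius_defect j t ^+ 2 < (q * m t) ^+ 2, b j t ^+ 2 < B t ^+ 2 &
                (a j t - 1) ^+ 2 < 2^-1 ^+ 2].

Let coefB_gt0 : 0 < 5 * ak * C1 / rate.
Proof. by rewrite divr_gt0// (mulr_gt0 _ C1_gt0)// mulr_gt0. Qed.

Let B_mono (s t : R) : s <= t -> B s <= B t.
Proof.
by move=> st; rewrite /B lerD2l lerN2 ler_pM2l ?m_mono.
Qed.

Let B_gt0 (t : R) : tau <= t -> 0 < B t.
Proof. by move=> /B_mono; exact: lt_le_trans. Qed.

Let B_le_eta (t : R) : B t <= eta.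
Proof.
apply: le_trans B_eta; rewrite /B lerBlDr lerDl.
by rewrite ltW// mulr_gt0.
Qed.

Let dB (t : R) : is_derive t 1 B (5 * ak * C1 * m t).
Proof.
have := dm t => dmt; rewrite /B; apply: is_derive_eq.
by rewrite /GRing.scale /=; field; exact: lt0r_neq0.
Qed.

Let drho j (t : R) : 0 < t -> is_derive t 1 (radius_defect j)
  (2 * (a j t * a_rate link alpha kappa a b gr j t +
        b j t * b_rate link alpha kappa a b gi j t)).
Proof.
move=> t0; have [da db] := sol j t0; rewrite /radius_defect.
apply: is_derive_eq; rewrite /GRing.scale /=; ring.
Qed.

Let dqm (t : R) : is_derive t 1 (fun x => q * m x) (- (rate * (q * m t))).
Proof.
have := dm t => dmt; apply: is_derive_eq.
by rewrite /GRing.scale /=; ring.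
Qed.

Let dV (t : R) : 0 < t -> is_derive t 1 V
  (2 * bilinear_form S (b^~ t) (fun j => b_rate link alpha kappa a b gi j t)).
Proof.
move=> t0; have := @is_derive_quadratic_form _ _ S b
  (fun j => b_rate link alpha kappa a b gi j t) t (fun j => (sol j t0).2).
by move/is_derive_eq; apply; rewrite S_sym; ring.
Qed.

Lemma inner_tube_tube (t : R) : tau <= t -> inner_tube t -> tube t.
Proof.
move=> tt [Vt It]; split; first exact: ltW.
move=> j; have [rj bj aj] := It j; split.
- by apply: square_le_norm; [rewrite ltW// mulr_gt0|exact: ltW].
- apply: le_trans (B_le_eta t).
  by apply: square_le_norm; [rewrite ltW// B_gt0|exact: ltW].
- by apply: square_le_norm; [rewrite invr_ge0|exact: ltW].
Qed.

(** The derivative of [b] is split into undelayed diffusion and an error [e]. The diffusion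
    contributes at most [- kappa * c * mu * m t ^+ 2], and [rate_V] says that this outweighs both
    the error and the decay of the barrier. *)
Lemma phase_form_decreasing (t : R) : tau < t ->
  (forall s, - tau <= s <= t -> tube s) ->
  V t = m t ^+ 2 ->
  bilinear_form S (b^~ t) (fun j => b_rate link alpha kappa a b gi j t) <
  - (rate * m t ^+ 2).
Proof.
move=> tt T Vm.
have t0 : 0 < t by exact: lt_trans tau0 tt.
have tau_t : - tau <= t - tau by move: tt tau0; lra.
have Tt : tube t by apply: T; move: tt tau0; lra.
have Td : tube (t - tau) by apply: T; move: tt tau0; lra.
pose M := m t; have M0 : 0 < M := m_gt0 t.
have mM s : t - 2 * tau <= s -> m s <= 2 * M by exact: m_window.
have M2_eta : cS * (2 * M) <= eta0.
  apply: le_trans K_eta0; rewrite ler_pM2l// ler_pM2l//.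
  exact: m_le_K (ltW t0).
(* Mean value theorem on [[t - tau, t]], where the speed is at most [4 * ak * C1 * M]; two nodes are
   involved. *)
have delayed i l : `|b l (t - tau) - b i (t - tau) - (b l t - b i t)| <=
    8 * ak * C1 * M * tau.
  have lip k : `|b k t - b k (t - tau)| <= 2 * ak * C1 * (2 * M) * tau.
    have {2}-> : tau = t - (t - tau) by ring.
    apply: lipschitz_of_derivative; first by rewrite gerBl ltW.
    move=> x xI; exists (b_rate link alpha kappa a b gi k x).
      by have [] := sol k (_ : 0 < x) => //; move: xI tt; lra.
    apply: b_rate_in_tube => //; first by move: xI tt; lra.
    - by apply: T; move: xI tt tau0; lra.
    - by apply: T; move: xI tt tau0; lra.
    - by apply: mM; move: xI tau0; lra.
    - by apply: mM; move: xI tau0; lra.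
  by move: (lip i) (lip l); rewrite !ler_norml; lra.
pose e j := b_rate link alpha kappa a b gi j t +
            kappa * c * laplacian_fun link (b^~ t) j.
pose E := alpha * eta * q * M +
  ak * (n%:R * ((2 * eps * cS + 8 * q + 8 * ak * C1 * tau) * M)).
have eE j : `|e j| <= E.
  have [_ /(_ j)[rj bj _]] := Tt.
  have al : `|alpha| <= alpha by rewrite gtr0_norm.
  have ab := norm_mul_le (norm_mul_le al bj) rj.
  have -> : e j = - (alpha * b j t * radius_defect j t) + kappa *
    \sum_l adjacency R link j l * (gi j l t - c * (b l t - b j t)).
    rewrite /e /b_rate /radius_defect /coupling_sum /laplacian_fun.
    have -> : \sum_l adjacency R link j l * (gi j l t - c * (b l t - b j t)) =
        \sum_l adjacency R link j l * gi j l t +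
        c * \sum_l adjacency R link j l * (b j t - b l t).
      by rewrite mulr_sumr -big_split; apply: eq_bigr => l _ /=; ring.
    by ring.
  have sumE : `|\sum_l adjacency R link j l * (gi j l t - c * (b l t - b j t))|
      <= n%:R * ((2 * eps * cS + 8 * q + 8 * ak * C1 * tau) * M).
    apply: adjacency_sum_le => l.
    have md : m (t - tau) <= 2 * M by apply: mM; move: tau0; lra.
    have [da db] := tube_diff Td j l.
    have md_eta : cS * m (t - tau) <= eta0.
      by apply: le_trans K_eta0; rewrite ler_pM2l// m_start.
    have cm : 0 <= cS * m (t - tau) <= eta0.
      by rewrite md_eta mulr_ge0// ltW.
    have db' : `|a l (t - tau) - a j (t - tau)| <= cS * m (t - tau).
      by apply: le_trans db _; rewrite ler_pM2r.
    have [_ gE] := est t0 cm db' da.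
    have := norm_mul_le c1 (delayed j l).
    have := norm_mul_le sg1 db.
    have : eps * cS * m (t - tau) <= eps * cS * (2 * M).
      by rewrite ler_pM2l// mulr_gt0.
    have : 4 * q * m (t - tau) <= 4 * q * (2 * M).
      by rewrite ler_pM2l// mulr_gt0.
    move: gE; rewrite !ler_norml; lra.
  have := norm_mul_le (lexx `|kappa|) sumE.
  move: ab; rewrite /E /M /ak !ler_norml; lra.
have -> : (fun j => b_rate link alpha kappa a b gi j t) =
    (fun j => - (kappa * c) * laplacian_fun link (b^~ t) j + e j).
  by apply/funext => j; rewrite /e; ring.
rewrite bilinear_form_combine.
have := S_bound (ltW M0) (Tt.1) eE; rewrite ler_norml => /andP[_ Be].
have := S_dissipative (b^~ t); rewrite -/(V t) Vm => Bd.
(* The left side of [rate_V] is positive, which fixes the sign of [kappa * c]. *)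
have kc0 : 0 < kappa * c.
  rewrite -(pmulr_lgt0 _ mu0); apply: le_lt_trans rate_V.
  by rewrite !(addr_ge0, mulr_ge0)// ltW.
have : kappa * c * (mu * m t ^+ 2) <=
  kappa * c * bilinear_form S (b^~ t) (laplacian_fun link (b^~ t)).
  by rewrite ler_pM2l.
have : (cS * (alpha * eta * q + ak * n%:R * (2 * eps * cS + 8 * q + 8 * ak * C1 * tau))
  + rate) * M ^+ 2 < kappa * c * mu * M ^+ 2.
  by rewrite ltr_pM2r// exprn_gt0.
move: Be; rewrite /E -/M; lra.
Qed.

(** Since [a^2 + b^2 = 1 + rho], the defect [rho] is damped at rate [2 alpha (1 + rho)], which is at
    least [3/2 alpha] because [K_q] gives [|rho| <= 1/4]. *)
Lemma radius_decreasing j (t : R) : tau < t ->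
  (forall s, - tau <= s <= t -> tube s) ->
  radius_defect j t ^+ 2 = (q * m t) ^+ 2 ->
  radius_defect j t * (2 * (a j t * a_rate link alpha kappa a b gr j t +
                  b j t * b_rate link alpha kappa a b gi j t)) <
  q * m t * - (rate * (q * m t)).
Proof.
move=> tt T rm; have t0 : 0 < t by exact: lt_trans tau0 tt.
have Tt : tube t by apply: T; move: tt tau0; lra.
have Td : tube (t - tau) by apply: T; move: tt tau0; lra.
have M0 : 0 < m t := m_gt0 t.
have mM : m t <= K := m_le_K (ltW t0).
have md : m (t - tau) <= 2 * m t by apply: m_window; move: tau0; lra.
have M2_eta : cS * (2 * m t) <= eta0.
  by apply: le_trans K_eta0; rewrite ler_pM2l// ler_pM2l.
have [Hr Hi] := coupling_in_tube t0 Td md M2_eta j.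
have [_ /(_ j)[rj bj aj]] := Tt.
have r4 : `|radius_defect j t| <= 4^-1.
  apply: (le_trans rj); apply: le_trans K_q.
  by rewrite ler_pM2l//; move: mM K0; lra.
have a2 : `|a j t| <= 3 / 2 by move: aj; rewrite !ler_norml; lra.
have b4 : `|b j t| <= 4^-1 by exact: le_trans bj eta4.
have kr := norm_mul_le (lexx `|kappa|) (norm_mul_le rj (norm_mul_le a2 Hr)).
have ki := norm_mul_le (lexx `|kappa|) (norm_mul_le rj (norm_mul_le b4 Hi)).
have -> : radius_defect j t * (2 * (a j t * a_rate link alpha kappa a b gr j t +
                  b j t * b_rate link alpha kappa a b gi j t)) =
   - (2 * alpha * (1 + radius_defect j t) * radius_defect j t ^+ 2) +
   2 * (kappa * (radius_defect j t * (a j t * coupling_sum link gr j t)))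
   + 2 * (kappa * (radius_defect j t * (b j t * coupling_sum link gi j t))).
  by rewrite /a_rate /b_rate /radius_defect; ring.
rewrite rm.
have damp : 2 * alpha * (3 / 4) * (q * m t) ^+ 2 <=
    2 * alpha * (1 + radius_defect j t) * (q * m t) ^+ 2.
  apply: ler_wpM2r; first exact: sqr_ge0.
  apply: ler_wpM2l; first by rewrite ltW// mulr_gt0.
  by move: r4; rewrite ler_norml; lra.
(* The 7 is [2 (3/2 + 1/4) 2]: the derivative of a square, the bounds on [a] and [b], and the
   doubling of the barrier under delay. *)
have : (7 * ak * C1 + rate * q) * (q * m t * m t) <
    3 / 2 * alpha * q * (q * m t * m t).
  by rewrite ltr_pM2r// mulr_gt0// mulr_gt0.
move: kr ki damp; rewrite -/ak !ler_norml; lra.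
Qed.

Lemma inner_tube_closed (t : R) : tau < t ->
  (forall s, tau <= s < t -> inner_tube s) -> inner_tube t.
Proof.
move=> tt before; have t0 : 0 < t by exact: lt_trans tau0 tt.
have half0 := is_derive_cst (2^-1 : R) t (1 : R).
have da j : is_derive t 1 (fun x => a j x - 1) (a_rate link alpha kappa a b gr j t).
  by have [? _] := sol j t0; apply: is_derive_eq; rewrite ?subr0.
have db j : is_derive t 1 (b j) (b_rate link alpha kappa a b gi j t).
  by have [] := sol j t0.
have dm2 : is_derive t 1 (fun x => V x - m x ^+ 2)
    (2 * bilinear_form S (b^~ t) (fun j => b_rate link alpha kappa a b gi j t)
     + 2 * (rate * m t ^+ 2)).
  have := dV t0 => dVt; have := dm t => dmt.
  by apply: is_derive_eq; rewrite /GRing.scale /=; ring.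
have r_before j s : tau <= s < t -> radius_defect j s ^+ 2 < (q * m s) ^+ 2.
  by move=> /before[_ /(_ j)[]].
have b_before j s : tau <= s < t -> b j s ^+ 2 < B s ^+ 2.
  by move=> /before[_ /(_ j)[]].
have a_before j s : tau <= s < t -> (a j s - 1) ^+ 2 < (cst 2^-1) s ^+ 2.
  by move=> /before[_ /(_ j)[]].
have V_before s : tau <= s < t -> V s - m s ^+ 2 < 0.
  by move=> /before[]; rewrite subr_lt0.
(* The weak bounds at [t] come first: the touching arguments below use the tube on all of
   [[- tau, t]], including its endpoint. *)
have Tt : tube t.
  split; first by rewrite -subr_le0; exact: left_limit_le0 tt dm2 V_before.
  move=> j; split.
  - apply: square_le_norm; first by rewrite ltW// mulr_gt0.
    exact: square_barrier_le tt (drho j t0) (dqm t) (r_before j).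
  - apply: le_trans (B_le_eta t).
    apply: square_le_norm; first by rewrite ltW// B_gt0// ltW.
    exact: square_barrier_le tt (db j) (dB t) (b_before j).
  - apply: square_le_norm; first by rewrite invr_ge0.
    exact: square_barrier_le tt (da j) half0 (a_before j).
have T s : - tau <= s <= t -> tube s.
  move=> /andP[s_ge]; rewrite le_eqVlt => /predU1P[->//|s_lt].
  have [st|ts] := leP s tau; first by apply: tube_start; rewrite s_ge st.
  by apply: inner_tube_tube; [exact: ltW|apply: before; rewrite ltW].
split.
  rewrite -subr_lt0; apply: (negative_touch tt dm2 V_before) => /eqP.
  rewrite subr_eq0 => /eqP Vm; have := phase_form_decreasing tt T Vm; lra.
move=> j; split.
- exact: square_barrier tt (drho j t0) (dqm t) (r_before j)
    (radius_decreasing tt T).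
- apply: (square_barrier tt (db j) (dB t) (b_before j)) => bB.
  have Bt : 0 < B t by rewrite B_gt0// ltW.
  have b_le : `|b j t| <= B t by apply: square_le_norm; [exact: ltW|rewrite bB].
  have md : m (t - tau) <= 2 * m t by apply: m_window; move: tau0; lra.
  have mM : m t <= K := m_le_K (ltW t0).
  have rate_le : `|b_rate link alpha kappa a b gi j t| <= 2 * ak * C1 * (2 * m t).
    apply: b_rate_in_tube => //.
    + by apply: T; move: tt tau0; lra.
    + by have := m_gt0 t; lra.
    + by apply: le_trans K_eta0; rewrite ler_pM2l// ler_pM2l.
  apply: (le_lt_trans (ler_norm _)); apply: (le_lt_trans (norm_mul_le b_le rate_le)).
  rewrite ltr_pM2l//.
  have : 0 < ak * C1 * m t by rewrite mulr_gt0// mulr_gt0.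
  lra.
- apply: (square_barrier tt (da j) half0 (a_before j)) => /= a_half.
  have [_ /(_ j)[rj bj aj]] := Tt.
  (* The barrier for [a] cannot be touched: [a = 3/2] or [a = 1/2] with [b^2 <= 1/16] is
     incompatible with a radius defect of at most 1/4. *)
  exfalso.
  have r4 : `|radius_defect j t| <= 4^-1.
    apply: (le_trans rj); apply: le_trans K_q; rewrite ler_pM2l//.
    by apply: m_start; move: tau0 t0; lra.
  have b4 : `|b j t| <= 4^-1 by exact: le_trans bj eta4.
  have b16 := norm_mul_le b4 b4.
  have /orP[/eqP|/eqP] : (a j t - 1 == 2^-1) || (a j t - 1 == - 2^-1).
    by rewrite -eqf_sqr a_half.
  + move=> a_eq; have {}a_eq : a j t = 3 / 2 by move: a_eq; lra.
    move: r4 b16; rewrite /radius_defect a_eq !ler_norml; lra.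
  + move=> a_eq; have {}a_eq : a j t = 2^-1 by move: a_eq; lra.
    move: r4 b16; rewrite /radius_defect a_eq !ler_norml; lra.
Qed.

Lemma inner_tube_forever (t : R) : tau <= t -> inner_tube t.
Proof.
move: t; apply: continuation; first exact: strict_start.
  exact: inner_tube_closed.
move=> t tt [Vt It]; have t0 : 0 < t by exact: lt_le_trans tau0 tt.
have near_V : \forall s \near t^'+, V s < m s ^+ 2.
  have cV : V x - m x * m x @[x --> t^'+] --> V t - m t * m t.
    have cm := derive_right_continuous (dm t).
    by apply: cvgB; [exact: derive_right_continuous (dV t0)|exact: cvgM].
  have := cvgr_lt _ cV 0; rewrite -expr2 subr_lt0 => /(_ _ Vt).
  by apply: filterS => s; rewrite -expr2 subr_lt0.
have near_j j : \forall s \near t^'+,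
    [/\ radius_defect j s ^+ 2 < (q * m s) ^+ 2, b j s ^+ 2 < B s ^+ 2 &
        (a j s - 1) ^+ 2 < 2^-1 ^+ 2].
  have [rj bj aj] := It j; have [da db] := sol j t0.
  have near_r := near_right_square_lt (derive_right_continuous (drho j t0))
    (derive_right_continuous (dqm t)) rj.
  have near_b := near_right_square_lt (derive_right_continuous db)
    (derive_right_continuous (dB t)) bj.
  have near_a : \forall s \near t^'+, (a j s - 1) ^+ 2 < 2^-1 ^+ 2.
    apply: (near_right_square_lt (g := cst 2^-1)) => //; last exact: cvg_cst.
    by apply: cvgB; [exact: derive_right_continuous da|exact: cvg_cst].
  by near=> s; split; near: s.
by near=> s; split; [near: s|near: s; apply: filter_forall].
Unshelve. all: by end_near. Qed.

Lemma tube_forever (t : R) : - tau <= t -> tube t.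
Proof.
move=> t_ge; have [tt|tt] := leP t tau; first by apply: tube_start; rewrite t_ge.
by apply: inner_tube_tube; [exact: ltW|apply: inner_tube_forever; exact: ltW].
Qed.

(** One phase coordinate [b r] has an exponentially small derivative and converges to some [l]. The
    other [b j] follow because their differences decay, and the [a j] because the radii tend to 1.
    As [|l| <= 1/2], the angle is [asin l]. *)
Lemma frame_limit : exists psi : R, forall j t, tau <= t ->
  let D := 2 * (q + 4 * ak * C1 / rate + cS) in
  `|a j t - cos psi| <= D * m t /\ `|b j t - sin psi| <= D * m t.
Proof.
pose r := Ordinal n0.
have db j t : tau <= t -> exists2 b', is_derive t 1 (b j) b' &
    `|b'| <= 4 * ak * C1 * K * expR (- (rate * t)).
  move=> tt; have t0 : 0 < t by exact: lt_le_trans tau0 tt.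
  exists (b_rate link alpha kappa a b gi j t); first by have [] := sol j t0.
  have -> : 4 * ak * C1 * K * expR (- (rate * t)) = 2 * ak * C1 * (2 * m t).
    by rewrite /m; ring.
  apply: b_rate_in_tube => //.
  - by apply: tube_forever; move: t0 tau0; lra.
  - by apply: tube_forever; move: t0 tt tau0; lra.
  - by have := m_gt0 t; lra.
  - by apply: m_window; move: tau0; lra.
  - apply: le_trans K_eta0; rewrite ler_pM2l// ler_pM2l//.
    exact: m_le_K (ltW t0).
have [l Hl] := exponential_limit rate0 (db r).
have l_root t : tau <= t -> `|b r t - l| <= 4 * ak * C1 / rate * m t.
  move=> /Hl; rewrite /m; congr (_ <= _); ring.
(* Positivity of [B tau] bounds the remaining drift of [b r] by [eta], and [eta <= 1/4]. *)
have half : `|l| <= 2^-1.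
  have [|_ /(_ r)[_ b_eta _]] := @tube_forever tau; first by move: tau0; lra.
  have : 0 < ak * C1 / rate * m tau by rewrite mulr_gt0// divr_gt0// mulr_gt0.
  have := l_root _ (lexx tau); move: B_tau B_eta eta4 b_eta.
  by rewrite /B !ler_norml; lra.
have l_dist j t : tau <= t -> `|b j t - l| <= (4 * ak * C1 / rate + cS) * m t.
  move=> tt; have Tt : tube t by apply: tube_forever; move: tt tau0; lra.
  have [db_jr _] := tube_diff Tt r j.
  by have := l_root _ tt; move: db_jr; rewrite !ler_norml; lra.
have l1 : -1 <= l <= 1 by move: half; rewrite ler_norml; lra.
exists (asin l) => j t tt D.
have mt := m_gt0 t.
have D0 : 0 <= 4 * ak * C1 / rate.
  by rewrite divr_ge0 ?(ltW rate0)// ltW// (mulr_gt0 _ C1_gt0)// mulr_gt0.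
have lD := l_dist j t tt.
have Dm : (4 * ak * C1 / rate + cS) * m t * 2 + 2 * (q * m t) = D * m t.
  by rewrite /D; ring.
rewrite cos_asin// asinK ?in_itv//=; split; last first.
  have : 0 < q * m t by rewrite mulr_gt0.
  have : 0 <= (4 * ak * C1 / rate + cS) * m t.
    by apply: le_trans lD.
  lra.
set A := Num.sqrt _; have A0 : 0 <= A by exact: sqrtr_ge0.
have A2 : A ^+ 2 = 1 - l ^+ 2.
  by rewrite sqr_sqrtr//; move: half; rewrite ler_norml; nra.
have [|_ /(_ j)[rj bj aj]] := tube_forever (t := t); first by move: tt tau0; lra.
have b4 : `|b j t| <= 4^-1 by exact: le_trans bj eta4.
have bl : `|b j t + l| <= 1 by move: b4 half; rewrite !ler_norml; lra.
(* As [A] is the cosine of [asin l], dividing the difference of squares by [a j t + A] costs a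
   factor 2, the one in [D]. *)
have sum_ge : 2^-1 <= a j t + A by move: aj; rewrite ler_norml; lra.
have : 2^-1 * `|a j t - A| <= `|(a j t + A) * (a j t - A)|.
  by rewrite normrM ler_wpM2r// (le_trans sum_ge)// ler_norm.
have -> : (a j t + A) * (a j t - A) = radius_defect j t - (b j t - l) * (b j t + l).
  transitivity (a j t ^+ 2 - A ^+ 2); first by ring.
  by rewrite A2 /radius_defect; ring.
have := norm_mul_le lD bl; move: rj; rewrite -Dm => rj lb HA.
suff : `|radius_defect j t - (b j t - l) * (b j t + l)| <=
    q * m t + (4 * ak * C1 / rate + cS) * m t by lra.
by move: rj lb; rewrite !ler_norml; lra.
Qed.

End Contraction.

(** * Choice of the constants *)

(** Applying the bound with [e := x] and [M] the square root of the form gives [M^2 <= c E M], and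
    [M] cancels. *)
Lemma bilinear_form_diag_le (R : realType) (n : nat) (S : 'I_n -> 'I_n -> R)
    (c E : R) (x : 'I_n -> R) :
  (forall (x e : 'I_n -> R) (E M : R), 0 <= M -> bilinear_form S x x <= M ^+ 2 ->
     (forall j, `|e j| <= E) -> `|bilinear_form S x e| <= c * E * M) ->
  0 <= c -> 0 <= E -> (forall j, `|x j| <= E) ->
  bilinear_form S x x <= (c * E) ^+ 2.
Proof.
move=> bound c0 E0 xE; have [v0|v0] := leP (bilinear_form S x x) 0.
  by rewrite (le_trans v0)// sqr_ge0.
pose M := Num.sqrt (bilinear_form S x x).
have M2 : M ^+ 2 = bilinear_form S x x by rewrite sqr_sqrtr// ltW.
have M0 : 0 < M by rewrite sqrtr_gt0.
have := bound x x E M (ltW M0); rewrite M2 lexx => /(_ isT xE).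
rewrite gtr0_norm// -M2 expr2 ler_pM2r// => McE.
by rewrite ler_pM// ltW.
Qed.

Lemma expR_le2 (R : realType) (x : R) : x <= 2^-1 -> expR x <= 2.
Proof.
move=> x2; have : 2^-1 <= expR (- x).
  by apply: le_trans (expR_ge1Dx _); lra.
by rewrite expRN lef_pV2 ?posrE ?expR_gt0.
Qed.

(** The order of quantifiers matters: [eps] precedes [eta0], since the radius on which [h] is linear
    up to [eps] depends on [eps]. Then [eta] and [rate] may depend on [kappa], and [delta] on
    everything before it. *)
Theorem rotating_frame_stability (R : realType) (n : nat) (link : rel 'I_n)
    (alpha tau c sg : R) :
  connected_network link -> diagonalizable (laplacian R[i] link) ->
  0 < alpha -> 0 < tau -> c != 0 -> `|c| <= 1 -> `|sg| <= 1 ->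
  exists kc eps : R, [/\ 0 < kc, 0 < eps &
    forall kappa eta0 : R, `|kappa| < kc -> 0 < kappa * c -> 0 < eta0 ->
    exists delta C rate : R, [/\ 0 < delta, 0 < C, 0 < rate &
      forall (a b : 'I_n -> R -> R) (gr gi : 'I_n -> 'I_n -> R -> R) (e : R),
      frame_solution link alpha kappa a b gr gi ->
      coupling_estimate tau c sg eps eta0 a b gr gi ->
      0 < e <= delta ->
      (forall j, a j x @[x --> 0^'+] --> a j 0) ->
      (forall j, b j x @[x --> 0^'+] --> b j 0) ->
      (forall (j : 'I_n) (t : R), - tau <= t <= 0 ->
         `|a j t - 1| <= e /\ `|b j t| <= e) ->
      exists psi : R, forall j t, 0 <= t ->
        `|a j t - cos psi| <= C * e * expR (- (rate * t)) /\
        `|b j t - sin psi| <= C * e * expR (- (rate * t))]].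
Proof.
move=> connected diag alpha0 tau0 c0 c1 sg1.
have [S [mu [cS [mu0 cS0 [S_sym S_diss] S_diff S_bound]]]] :=
  laplacian_lyapunov_form connected diag.
have n0 : (0 < n)%N by have [r _] := connected; exact: leq_trans (ltn_ord r).
have N0 : 0 < n%:R :> R by rewrite ltr0n.
have ac0 : 0 < `|c| by rewrite normr_gt0.
pose C1 : R := 3 * n%:R * cS.
have C10 : 0 < C1 by rewrite !mulr_gt0.
(* The bounds on [q], [eps], [kc], [eta] and [rate] each make one term of [rate_V] at most an eighth
   of [kappa * c * mu]; five eighths leave a margin. *)
pose q : R := Num.min (cS / 4) (`|c| * mu / (64 * n%:R * cS)).
have q0 : 0 < q by rewrite lt_min !divr_gt0// !mulr_gt0.
have /andP[q_cS q_c] : (q <= cS / 4) && (q <= `|c| * mu / (64 * n%:R * cS)).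
  by rewrite -le_min.
rewrite ler_pdivlMr ?mulr_gt0// in q_c.
pose eps : R := Num.min 1 (`|c| * mu / (16 * n%:R * (cS * cS))).
have eps0 : 0 < eps by rewrite lt_min ltr01 !divr_gt0// !mulr_gt0.
have /andP[eps1 eps_c] : (eps <= 1) && (eps <= `|c| * mu / (16 * n%:R * (cS * cS))).
  by rewrite -le_min.
rewrite ler_pdivlMr ?mulr_gt0// in eps_c.
pose kc : R := Num.min (`|c| * mu / (64 * n%:R * cS * C1 * tau))
  (alpha * q / (14 * C1)).
have kc0 : 0 < kc by rewrite lt_min !divr_gt0// !mulr_gt0.
exists kc, eps; split=> // kappa eta0 + kappa_c eta0_gt0.
rewrite lt_min ltr_pdivlMr ?ltr_pdivlMr ?mulr_gt0// => /andP[k_c k_alpha].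
have kappa0 : kappa != 0.
  by apply: contraTneq kappa_c => ->; rewrite mul0r ltxx.
pose ak : R := `|kappa|.
have ak0 : 0 < ak by rewrite normr_gt0.
have akc : kappa * c = ak * `|c| by rewrite -normrM gtr0_norm.
have akcm : 0 < ak * `|c| * mu by rewrite !mulr_gt0.
pose eta : R := Num.min 4^-1 (Num.min (q / cS) (Num.min (ak * C1 / (alpha * q))
  (ak * `|c| * mu / (8 * cS * alpha * q)))).
have eta_gt0 : 0 < eta.
  have akC1 : 0 < ak * C1 by exact: mulr_gt0.
  have aq : 0 < alpha * q by exact: mulr_gt0.
  have caq : 0 < 8 * cS * alpha * q by rewrite !mulr_gt0.
  by rewrite !lt_min invr_gt0 !divr_gt0// ltr0n.
have /and4P[eta4 eta_q eta_k eta_c] : [&& eta <= 4^-1, eta <= q / cS,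
    eta <= ak * C1 / (alpha * q) & eta <= ak * `|c| * mu / (8 * cS * alpha * q)].
  by rewrite -!le_min.
rewrite ler_pdivlMr// in eta_q.
rewrite ler_pdivlMr ?mulr_gt0// in eta_k.
rewrite ler_pdivlMr ?mulr_gt0// in eta_c.
pose rate : R := Num.min (ak * `|c| * mu / 8) (Num.min (alpha / 2) (4 * tau)^-1).
have rate0 : 0 < rate by rewrite !lt_min !divr_gt0// invr_gt0 mulr_gt0.
have /and3P[rate_c rate_alpha rate_tau] :
  [&& rate <= ak * `|c| * mu / 8, rate <= alpha / 2 & rate <= (4 * tau)^-1].
  by rewrite -!le_min.
rewrite -[(4 * tau)^-1]mul1r ler_pdivlMr ?mulr_gt0// in rate_tau.
have exp2 : expR (rate * (2 * tau)) <= 2.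
  by apply: expR_le2; move: rate_tau; clear; lra.
have rate_V : cS * (alpha * eta * q +
    ak * n%:R * (2 * eps * cS + 8 * q + 8 * ak * C1 * tau)) + rate <
    kappa * c * mu.
  move: (ler_wpM2l (ltW ak0) q_c) (ler_wpM2l (ltW ak0) eps_c).
  move: (ler_wpM2l (ltW ak0) (ltW k_c)); rewrite akc -/ak.
  move: eta_c rate_c akcm; clear; lra.
have rate_rho : 7 * ak * C1 + rate * q < 3 / 2 * alpha * q.
  move: (ler_wpM2r (ltW q0) rate_alpha) (mulr_gt0 alpha0 q0) k_alpha.
  rewrite -/ak; clear; lra.
(* [g0 * e] bounds the perturbation on [[- tau, tau]]. Then [K = k0 * e] puts [V] and the radii
   below their barriers there, where [m >= K / 2], and [b0 * e] is the height [B0] of the barrier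
   for [b]. *)
pose Lambda := 4 * alpha + 6 * n%:R * ak + 1.
pose g0 : R := 2 * expR (Lambda * tau).
have g00 : 0 < g0 by rewrite mulr_gt0// expR_gt0.
pose k0 : R := 2 * (cS * g0) + 6 * g0 / q + 1.
have k00 : 0 < k0.
  have : 0 < 6 * g0 / q by rewrite divr_gt0// mulr_gt0.
  by move: (mulr_gt0 cS0 g00); rewrite /k0; clear; lra.
pose coef : R := 5 * ak * C1 / rate.
have coef0 : 0 < coef by rewrite divr_gt0// !mulr_gt0.
pose b0 : R := coef * k0 + g0 + 1.
have b00 : 0 < b0.
  by move: (mulr_gt0 coef0 k00) g00; rewrite /b0; clear; lra.
pose D : R := 2 * (q + 4 * ak * C1 / rate + cS).
have D0 : 0 < D.
  have : 0 < 4 * ak * C1 / rate by rewrite divr_gt0// !mulr_gt0.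
  by move: q0 cS0; rewrite /D; clear; lra.
have Dk0 : 0 < D * k0 by exact: mulr_gt0.
have ck0 : 0 < cS * (2 * k0) by rewrite mulr_gt0// mulr_gt0.
have qk0 : 0 < q * (2 * k0) by rewrite mulr_gt0// mulr_gt0.
(* In order, the entries ensure [2 e <= eta0], [g0 e <= 1/4], [2 cS K <= eta0], [2 q K <= 1/4] and
   [b0 e <= eta]. *)
pose delta : R := Num.min (eta0 / 2) (Num.min (4^-1 / g0) (Num.min
  (eta0 / (cS * (2 * k0))) (Num.min (4^-1 / (q * (2 * k0))) (eta / b0)))).
exists delta, (2 * (2 * g0 + D * k0)), rate; split=> //.
- by rewrite !lt_min !divr_gt0// invr_gt0.
- by move: g00 Dk0; clear; lra.
move=> a b gr gi e sol est /andP[e0] + ac bc hist.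
rewrite !le_min => /and5P[]; rewrite !ler_pdivlMr//.
move=> e_eta0 e_g0 e_cS e_q e_b0.
have start (j : 'I_n) (t : R) : - tau <= t <= tau ->
    `|a j t - 1| <= g0 * e /\ `|b j t| <= g0 * e.
  move=> tI; have := growth_from_history c1 sg1 eps1 alpha0 tau0 sol est e0.
  rewrite -/ak -/Lambda (_ : 2 * e * _ = g0 * e); last by rewrite /g0; ring.
  by apply=> //; rewrite mulrC.
pose K : R := k0 * e; have K0 : 0 < K by rewrite mulr_gt0.
have exp_half (t : R) : t <= tau -> 2^-1 <= expR (- (rate * t)).
  move=> tt; rewrite expRN lef_pV2 ?posrE ?expR_gt0//; apply: le_trans exp2.
  by rewrite ler_expR ler_pM2l//; move: tt tau0; clear; lra.
pose m (t : R) := K * expR (- (rate * t)).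
have m_half (t : R) : t <= tau -> K / 2 <= m t.
  by move=> /exp_half; rewrite /m ler_pM2l.
have ge0 : 0 < g0 * e by rewrite mulr_gt0.
have K2 : K / 2 = cS * (g0 * e) + 3 * (g0 * e) / q + e / 2.
  by rewrite /K /k0; field; exact: lt0r_neq0.
have g4 : g0 * e <= 4^-1 by rewrite mulrC.
have V_start (t : R) : - tau <= t <= tau ->
    bilinear_form S (b^~ t) (b^~ t) < m t ^+ 2.
  move=> tI; apply: le_lt_trans (_ : (cS * (g0 * e)) ^+ 2 < _).
    apply: (bilinear_form_diag_le S_bound); rewrite ?(ltW cS0) ?(ltW ge0)//.
    by move=> j; have [] := start j t tI.
  apply: norm_lt_square; rewrite gtr0_norm; last exact: mulr_gt0.
  apply: (@lt_le_trans _ _ (K / 2)); last by apply: m_half; case/andP: tI.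
  have : 0 < 3 * (g0 * e) / q by rewrite divr_gt0// mulr_gt0.
  by rewrite K2; move: e0; clear; lra.
have rho_start : forall (j : 'I_n) (t : R), - tau <= t <= tau ->
    `|radius_defect a b j t| < q * m t.
  move=> j t tI; have [a_le b_le] := start j t tI.
  apply: (@lt_le_trans _ _ (q * (K / 2))); last first.
    by rewrite ler_pM2l//; apply: m_half; case/andP: tI.
  have -> : q * (K / 2) = q * (cS * (g0 * e)) + 3 * (g0 * e) + q * e / 2.
    by rewrite K2; field; exact: lt0r_neq0.
  move: (mulr_gt0 q0 (mulr_gt0 cS0 ge0)).
  have : 0 < q * e / 2 by rewrite divr_gt0// mulr_gt0.
  move: (norm_mul_le a_le a_le) (norm_mul_le b_le b_le) (a_le) (b_le).
  have : g0 * e * (g0 * e) <= g0 * e * 4^-1 by rewrite ler_pM2l.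
  rewrite /radius_defect !ler_norml ltr_norml; move: ge0; clear; lra.
have b_eta : b0 * e <= eta by rewrite mulrC.
have m_tau : coef * m tau <= coef * K.
  rewrite ler_pM2l// /m ler_piMr ?(ltW K0)// -expR0 ler_expR oppr_le0.
  by rewrite mulr_ge0// ltW.
have B_tau : g0 * e < b0 * e - coef * m tau.
  by move: m_tau e0; rewrite /b0 /K; clear; lra.
have tau_in : - tau <= tau <= tau by rewrite lexx andbT ge0_cp// ltW.
have [psi lim] : exists psi : R, forall (j : 'I_n) (t : R), tau <= t ->
    `|a j t - cos psi| <= D * m t /\ `|b j t - sin psi| <= D * m t.
  refine (frame_limit n0 kappa0 c1 sg1 eps0 eps1 alpha0 tau0 sol est mu0 cS0
    S_sym S_diss S_diff S_bound q0 _ eta_gt0 eta4 _ _ rate0 exp2 rate_V rate_rho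
    K0 _ _ (lt_trans ge0 B_tau) b_eta _ _).
  - by move: q_cS; clear; lra.
  - by rewrite mulrC.
  - by move: eta_k; rewrite /C1 /ak; clear; lra.
  - by move: e_cS; rewrite /K; clear; lra.
  - by move: e_q; rewrite /K; clear; lra.
  - move=> t tI; split; first by apply: ltW; exact: V_start.
    move=> j; have [a_le b_le] := start j t tI.
    split; first by apply: ltW; exact: rho_start.
    + apply: le_trans b_le _; apply: le_trans b_eta; rewrite ler_pM2r//.
      by move: (mulr_gt0 coef0 k00); rewrite /b0; clear; lra.
    + by apply: le_trans a_le _; move: g4; clear; lra.
  - split; first exact: V_start.
    move=> j; have [a_le b_le] := start j tau tau_in; split.
    + exact/norm_lt_square/rho_start.
    + exact/norm_lt_square/(le_lt_trans b_le B_tau).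
    + apply: norm_lt_square; apply: le_lt_trans a_le _.
      by move: g4; clear; lra.
exists psi => j t t0.
have E_gt0 := expR_gt0 (- (rate * t)).
have eE0 : 0 < e * expR (- (rate * t)) by rewrite mulr_gt0.
have [tt|tt] := leP tau t.
  have [a_le b_le] := lim j t tt.
  have DC : D * m t <= 2 * (2 * g0 + D * k0) * e * expR (- (rate * t)).
    rewrite /m /K.
    move: (mulr_gt0 g00 eE0) (mulr_gt0 Dk0 eE0); clear; lra.
  by split; [apply: le_trans a_le DC|apply: le_trans b_le DC].
(* Before [tau] the distance to the limit is estimated through the values at [tau]; the exponential
   is at least 1/2 there, hence the outer factor 2 in [C]. *)
have [a_tau b_tau] := start j tau tau_in.
have tI : - tau <= t <= tau by move: t0 tt tau0; clear; lra.
have [a_t b_t] := start j t tI.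
have [a_lim b_lim] := lim j tau (lexx _).
have Dm : D * m tau <= D * K.
  by rewrite ler_pM2l//; rewrite -(ler_pM2l coef0).
have bound : (2 * g0 + D * k0) * e <=
    2 * (2 * g0 + D * k0) * e * expR (- (rate * t)).
  have -> : 2 * (2 * g0 + D * k0) * e * expR (- (rate * t)) =
    (2 * g0 + D * k0) * e * (2 * expR (- (rate * t))) by ring.
  rewrite ler_peMr//; first by rewrite ltW// mulr_gt0// addr_gt0// mulr_gt0.
  by move: (exp_half t (ltW tt)); clear; lra.
move: Dm; rewrite /K => Dm.
split; apply: le_trans bound.
  by move: a_tau a_t a_lim Dm; clear; rewrite !ler_norml; lra.
by move: b_tau b_t b_lim Dm; clear; rewrite !ler_norml; lra.
Qed.

(** * The network *)

Lemma is_derive_cvg (R : realType) (V : normedModType R) (f : R -> V) (t : R)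
    (df : V) :
  h^-1 *: (f (h *: 1 + t) - f t) @[h --> 0^'] --> df -> is_derive t 1 f df.
Proof.
move=> fdf; apply: DeriveDef; first by apply: cvgP fdf.
exact: (cvg_lim (@norm_hausdorff _ _) fdf).
Qed.

Lemma is_derive_pairE (R : realType) (f : R -> R * R) (t : R) (df : R * R) :
  is_derive t 1 f df <->
  is_derive t 1 (fun s => (f s).1) df.1 /\ is_derive t 1 (fun s => (f s).2) df.2.
Proof.
case: df => d1 d2 /=; split=> [[f_cvg f_val]|[f1 f2]].
  have {}f_cvg : h^-1 *: (f (h *: 1 + t) - f t) @[h --> 0^'] --> (d1, d2).
    by rewrite -f_val; exact: f_cvg.
  split; apply: is_derive_cvg.
    exact: (cvg_comp _ fst f_cvg cvg_fst).
  exact: (cvg_comp _ snd f_cvg cvg_snd).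
have {}f1 : h^-1 *: ((f (h *: 1 + t)).1 - (f t).1) @[h --> 0^'] --> d1.
  by have [H <-] := f1; exact: H.
have {}f2 : h^-1 *: ((f (h *: 1 + t)).2 - (f t).2) @[h --> 0^'] --> d2.
  by have [H <-] := f2; exact: H.
by apply: is_derive_cvg; exact: (cvg_pair f1 f2).
Qed.

(** Differentiability at 0 with identity derivative. The norm of [R * R] is the maximum norm, so
    both components are bounded at once; halving the radius yields the strict inequality of the
    ball. *)
Lemma coupling_linearization (R : realType) (h : R[i] -> R[i]) (eps : R) :
  coupling_function h -> 0 < eps ->
  exists2 r : R, 0 < r & forall (z : R[i]) (M : R), M <= r ->
    `|complex.Re z| <= M -> `|complex.Im z| <= M ->
    `|complex.Re (h z) - complex.Re z| <= eps * M /\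
    `|complex.Im (h z) - complex.Im z| <= eps * M.
Proof.
move=> [_ dh h0 h'0] eps0.
have /eqaddoP/(_ _ eps0) := diff_locally (dh 0).
case/nbhs_normP => r /= r0 near0; exists (r / 2); first by rewrite divr_gt0.
move=> z M Mr zx zy.
have zM : `|toR2 z| <= M by rewrite prod_normE ge_max zx zy.
have := near0 (toR2 z); rewrite /ball_ /= sub0r normrN => near0z.
have {near0z} : `|toR2 (h z) - toR2 z| <= eps * M.
  apply: le_trans (_ : eps * `|toR2 z| <= _); last by rewrite ler_pM2l.
  have /near0z : `|toR2 z| < r by apply: (le_lt_trans zM); lra.
  rewrite [X in `|X| <= _](_ : _ = toR2 (h z) - toR2 z)//.
  transitivity (real_map h (toR2 z + 0) -
    (real_map h 0 + 'd (real_map h) 0 (toR2 z))); first by [].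
  have -> : real_map h 0 = 0.
    by rewrite /real_map /ofR2 /= -[_ +i* _]/(0 : R[i]) h0.
  rewrite addr0 h'0.
  by rewrite add0r; case: (z).
rewrite prod_normE ge_max => /andP[hx hy].
by split; [exact: hx|exact: hy].
Qed.

Lemma cmod_def (R : realType) (z : R[i]) :
  cmod z = Num.sqrt (complex.Re z ^+ 2 + complex.Im z ^+ 2).
Proof. by rewrite /cmod normc_def. Qed.

Lemma Im_le_cmod (R : realType) (z : R[i]) : `|complex.Im z| <= cmod z.
Proof. by rewrite cmod_def -sqrtr_sqr ler_wsqrtr// lerDr sqr_ge0. Qed.

Lemma cmod_le_sum (R : realType) (z : R[i]) :
  cmod z <= `|complex.Re z| + `|complex.Im z|.
Proof.
rewrite cmod_def -[leRHS]ger0_norm ?addr_ge0// -sqrtr_sqr ler_wsqrtr//.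
by rewrite sqrrD !real_normK ?num_real// addrAC lerDl mulrn_wge0// mulr_ge0.
Qed.

Lemma complex_ReB (R : realType) (v w : R[i]) :
  complex.Re (v - w) = complex.Re v - complex.Re w.
Proof. by case: v w => [? ?] []. Qed.

Lemma complex_ImB (R : realType) (v w : R[i]) :
  complex.Im (v - w) = complex.Im v - complex.Im w.
Proof. by case: v w => [? ?] []. Qed.

Lemma Im_sum (R : realType) (I : Type) (r : seq I) (P : pred I)
    (F : I -> R[i]) :
  complex.Im (\sum_(i <- r | P i) F i) = \sum_(i <- r | P i) complex.Im (F i).
Proof. by apply: big_morph => // -[a b] [c d]. Qed.

Section Translation.
Variables (R : realType) (n : nat) (link : rel 'I_n) (h : R[i] -> R[i]).
Variables (alpha beta kappa tau s : R).
Hypotheses (alpha0 : 0 < alpha) (h_coupling : coupling_function h).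
Variable z : 'I_n -> R -> R[i].

Let ra := Num.sqrt alpha.
Let angle (t : R) := beta * (t + s).
Let x j t := complex.Re (z j t).
Let y j t := complex.Im (z j t).

(* [frame_re w t + i frame_im w t] is [w e^{- i beta (t + s)} / sqrt alpha]. *)
Definition frame_re (w : R[i]) (t : R) : R :=
  (complex.Re w * cos (angle t) + complex.Im w * sin (angle t)) / ra.

Definition frame_im (w : R[i]) (t : R) : R :=
  (complex.Im w * cos (angle t) - complex.Re w * sin (angle t)) / ra.

Definition frame_coupling (f : R[i] -> R -> R) (j l : 'I_n) (t : R) : R :=
  f (h (z l (t - tau) - z j (t - tau))) t.

Let ra_gt0 : 0 < ra.
Proof. by rewrite sqrtr_gt0. Qed.

Let ra2 : ra ^+ 2 = alpha.
Proof. by rewrite sqr_sqrtr// ltW. Qed.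

Let Re_field j t : complex.Re (vector_field link h alpha beta kappa tau z j t) =
  alpha * x j t - beta * y j t - x j t * (x j t ^+ 2 + y j t ^+ 2) +
  kappa * \sum_l adjacency R link j l *
     complex.Re (h (z l (t - tau) - z j (t - tau))).
Proof.
rewrite /vector_field -add_Re2_Im2 -/(x j t) -/(y j t) /x /y.
rewrite (_ : \sum_l adjacency R link j l * _ = complex.Re
  (\sum_(l < n) adjacency R[i] link j l * h (z l (t - tau) - z j (t - tau))));
  last first.
  rewrite Re_sum; apply: eq_bigr => l _; rewrite !mxE.
  by case: ifP => _; rewrite ?mul1r ?mul0r.
case: (\sum_(l < n) _) => u v; case: (z j t) => p q /=; ring.
Qed.

Let Im_field j t : complex.Im (vector_field link h alpha beta kappa tau z j t) =
  alpha * y j t + beta * x j t - y j t * (x j t ^+ 2 + y j t ^+ 2) +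
  kappa * \sum_l adjacency R link j l *
     complex.Im (h (z l (t - tau) - z j (t - tau))).
Proof.
rewrite /vector_field -add_Re2_Im2 -/(x j t) -/(y j t) /x /y.
rewrite (_ : \sum_l adjacency R link j l * _ = complex.Im
  (\sum_(l < n) adjacency R[i] link j l * h (z l (t - tau) - z j (t - tau))));
  last first.
  rewrite Im_sum; apply: eq_bigr => l _; rewrite !mxE.
  by case: ifP => _; rewrite ?mul1r ?mul0r.
case: (\sum_(l < n) _) => u v; case: (z j t) => p q /=; ring.
Qed.

Let frame_sq j t : frame_re (z j t) t ^+ 2 + frame_im (z j t) t ^+ 2 =
  (x j t ^+ 2 + y j t ^+ 2) / alpha.
Proof.
have cs := cos2Dsin2 (angle t).
rewrite /frame_re /frame_im -ra2 -/(x j t) -/(y j t).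
transitivity ((x j t ^+ 2 + y j t ^+ 2) *
  (cos (angle t) ^+ 2 + sin (angle t) ^+ 2) / ra ^+ 2); last by rewrite cs mulr1.
by field; exact: lt0r_neq0.
Qed.

(** The rotation absorbs the frequency [beta], the scaling turns the cubic term into
    [alpha a (1 - a^2 - b^2)], and the coupling enters linearly, so it is rotated term by term. *)
Lemma frame_network_solution :
  network_solution link h alpha beta kappa tau z ->
  frame_solution link alpha kappa (fun j t => frame_re (z j t) t)
    (fun j t => frame_im (z j t) t)
    (frame_coupling frame_re) (frame_coupling frame_im).
Proof.
move=> sol j t t0; have [_ /(_ t t0) /is_derive_pairE[]] := sol j.
rewrite /toR2 /= Re_field Im_field => dx dy.
have dangle : is_derive t 1 angle beta.
  by rewrite /angle; apply: is_derive_eq; rewrite /GRing.scale /=; ring.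
have dcos : is_derive t 1 (fun u => cos (angle u)) (- sin (angle t) * beta).
  by apply: is_derive1_comp.
have dsin : is_derive t 1 (fun u => sin (angle u)) (cos (angle t) * beta).
  by apply: is_derive1_comp.
have sq := frame_sq j t.
split; rewrite /a_rate /b_rate /coupling_sum /frame_coupling.
  rewrite -addrA -opprD sq.
  rewrite (_ : \sum_l _ = ((\sum_l adjacency R link j l *
        complex.Re (h (z l (t - tau) - z j (t - tau)))) * cos (angle t) +
      (\sum_l adjacency R link j l *
        complex.Im (h (z l (t - tau) - z j (t - tau)))) * sin (angle t)) / ra);
    last first.
    rewrite !mulr_suml -big_split mulr_suml; apply: eq_bigr => l _ /=.
    by rewrite /frame_re; ring.
  rewrite /frame_re; apply: is_derive_eq.
  rewrite /GRing.scale /= -/(x j t) -/(y j t).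
  by field; rewrite !lt0r_neq0.
rewrite -addrA -opprD sq.
rewrite (_ : \sum_l _ = ((\sum_l adjacency R link j l *
      complex.Im (h (z l (t - tau) - z j (t - tau)))) * cos (angle t) -
    (\sum_l adjacency R link j l *
      complex.Re (h (z l (t - tau) - z j (t - tau)))) * sin (angle t)) / ra);
  last first.
  rewrite !mulr_suml -sumrB mulr_suml; apply: eq_bigr => l _ /=.
  by rewrite /frame_im; ring.
rewrite /frame_im; apply: is_derive_eq.
rewrite /GRing.scale /= -/(x j t) -/(y j t).
by field; rewrite !lt0r_neq0.
Qed.

Let rotate_back (w : R[i]) (t : R) :
  complex.Re w = ra * (frame_re w t * cos (angle t) - frame_im w t * sin (angle t)) /\
  complex.Im w = ra * (frame_re w t * sin (angle t) + frame_im w t * cos (angle t)).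
Proof.
have cs := cos2Dsin2 (angle t); rewrite /frame_re /frame_im.
split.
  transitivity (complex.Re w * (cos (angle t) ^+ 2 + sin (angle t) ^+ 2)).
    by rewrite cs mulr1.
  by field; exact: lt0r_neq0.
transitivity (complex.Im w * (cos (angle t) ^+ 2 + sin (angle t) ^+ 2)).
  by rewrite cs mulr1.
by field; exact: lt0r_neq0.
Qed.

Lemma frame_le (w : R[i]) (t B : R) :
  `|complex.Re w| <= B -> `|complex.Im w| <= B ->
  `|frame_re w t| <= 2 * B / ra /\ `|frame_im w t| <= 2 * B / ra.
Proof.
move=> wx wy.
have c1 : `|cos (angle t)| <= 1 by rewrite ler_norml cos_geN1 cos_le1.
have s1 : `|sin (angle t)| <= 1 by rewrite ler_norml sin_geN1 sin_le1.
have ri : `|ra^-1| <= ra^-1 by rewrite gtr0_norm// invr_gt0.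
have sum u v : `|u| <= B -> `|v| <= B ->
    `|u * cos (angle t) + v * sin (angle t)| <= 2 * B.
  move=> uB vB; have := norm_mul_le uB c1; have := norm_mul_le vB s1.
  by rewrite !ler_norml; lra.
split; apply: norm_mul_le ri; first exact: sum.
by rewrite -mulNr; apply: sum; rewrite ?normrN.
Qed.

Let frame_reB (v w : R[i]) (t : R) :
  frame_re (v - w) t = frame_re v t - frame_re w t.
Proof.
by rewrite /frame_re complex_ReB complex_ImB -mulrBl; congr (_ / _); ring.
Qed.

Let frame_imB (v w : R[i]) (t : R) :
  frame_im (v - w) t = frame_im v t - frame_im w t.
Proof.
by rewrite /frame_im complex_ReB complex_ImB -mulrBl; congr (_ / _); ring.
Qed.

Let back_le (w : R[i]) (t B : R) :
  `|frame_re w t| <= B -> `|frame_im w t| <= B ->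
  `|complex.Re w| <= 2 * ra * B /\ `|complex.Im w| <= 2 * ra * B.
Proof.
move=> wx wy; have [-> ->] := rotate_back w t.
have c1 : `|cos (angle t)| <= 1 by rewrite ler_norml cos_geN1 cos_le1.
have s1 : `|sin (angle t)| <= 1 by rewrite ler_norml sin_geN1 sin_le1.
have ra_n : `|ra| <= ra by rewrite gtr0_norm.
have -> : 2 * ra * B = ra * (2 * B) by ring.
split; apply: (norm_mul_le ra_n).
  by move: (norm_mul_le wx c1) (norm_mul_le wy s1); rewrite !ler_norml; lra.
by move: (norm_mul_le wx s1) (norm_mul_le wy c1); rewrite !ler_norml; lra.
Qed.

(** The frame turns by [beta * tau] during the delay. This is where [cos (beta * tau)], whose sign
    decides stability, enters. *)
Let frame_delay (w : R[i]) (t : R) :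
  frame_re w t = cos (beta * tau) * frame_re w (t - tau) +
                 sin (beta * tau) * frame_im w (t - tau) /\
  frame_im w t = cos (beta * tau) * frame_im w (t - tau) -
                 sin (beta * tau) * frame_re w (t - tau).
Proof.
have -> : beta * tau = angle t - angle (t - tau) by rewrite /angle; ring.
have [wx wy] := rotate_back w (t - tau).
rewrite {1}/frame_re {2}/frame_im wx wy cosB sinB.
by split; field; exact: lt0r_neq0.
Qed.

(** Passing from the frame to components costs [2 * ra] and passing back costs [2 / ra]; this
    explains [eps / 4] and [r / (2 * ra)]. *)
Lemma frame_coupling_estimate (eps r : R) :
  (forall (w : R[i]) (M : R), M <= r ->
    `|complex.Re w| <= M -> `|complex.Im w| <= M ->
    `|complex.Re (h w) - complex.Re w| <= eps / 4 * M /\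
    `|complex.Im (h w) - complex.Im w| <= eps / 4 * M) ->
  coupling_estimate tau (cos (beta * tau)) (sin (beta * tau)) eps (r / (2 * ra))
    (fun j t => frame_re (z j t) t) (fun j t => frame_im (z j t) t)
    (frame_coupling frame_re) (frame_coupling frame_im).
Proof.
move=> lin j l t M t0 /andP[M0 Mr]; rewrite -frame_reB -frame_imB => da db.
set w := z l (t - tau) - z j (t - tau) in da db *.
have [wx wy] := back_le da db.
have Br : 2 * ra * M <= r by move: Mr; rewrite ler_pdivlMr ?mulr_gt0// mulrC.
have [hx hy] := lin w _ Br wx wy.
have [<- <-] := frame_delay w t.
rewrite /frame_coupling -/w -frame_reB -frame_imB.
have -> : eps * M = 2 * (eps / 4 * (2 * ra * M)) / ra.
  by field; exact: lt0r_neq0.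
by rewrite -complex_ReB in hx; rewrite -complex_ImB in hy; exact: frame_le.
Qed.

(** A rotation by [psi] is a time shift by [psi / beta]; this turns the limit angle into an
    asymptotic phase. *)
Let frame_orbit (j : 'I_n) (t psi : R) : beta != 0 ->
  frame_re (synchronous_orbit alpha beta j (t + (s + psi / beta))) t = cos psi /\
  frame_im (synchronous_orbit alpha beta j (t + (s + psi / beta))) t = sin psi.
Proof.
move=> beta0; rewrite /frame_re /frame_im /synchronous_orbit /=.
have -> : beta * (t + (s + psi / beta)) = angle t + psi.
  by rewrite /angle; field.
have cs := cos2Dsin2 (angle t); rewrite !(mul0r, subr0, addr0) cosD sinD -/ra.
split.
  transitivity (cos psi * (cos (angle t) ^+ 2 + sin (angle t) ^+ 2)).
    by field; exact: lt0r_neq0.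
  by rewrite cs mulr1.
transitivity (sin psi * (cos (angle t) ^+ 2 + sin (angle t) ^+ 2)).
  by field; exact: lt0r_neq0.
by rewrite cs mulr1.
Qed.

Lemma frame_of_near_orbit (j : 'I_n) (w : R[i]) (t e : R) : beta != 0 ->
  cmod (w - synchronous_orbit alpha beta j (t + s)) <= e ->
  `|frame_re w t - 1| <= 2 * e / ra /\ `|frame_im w t| <= 2 * e / ra.
Proof.
move=> beta0 we; have [p1 p2] := frame_orbit j t 0 beta0.
rewrite mul0r addr0 cos0 in p1; rewrite mul0r addr0 sin0 in p2.
have [] := frame_le t (le_trans (Re_le_cmod _) we) (le_trans (Im_le_cmod _) we).
by rewrite frame_reB frame_imB p1 p2 subr0.
Qed.

Lemma near_orbit_of_frame (j : 'I_n) (w : R[i]) (t psi E : R) : beta != 0 ->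
  `|frame_re w t - cos psi| <= E -> `|frame_im w t - sin psi| <= E ->
  cmod (w - synchronous_orbit alpha beta j (t + (s + psi / beta))) <= 4 * ra * E.
Proof.
move=> beta0; have [<- <-] := frame_orbit j t psi beta0.
rewrite -frame_reB -frame_imB => da db; apply: le_trans (cmod_le_sum _) _.
have [dx dy] := back_le da db; lra.
Qed.

Lemma frame_right_continuous : 0 < tau ->
  network_solution link h alpha beta kappa tau z -> forall j,
  frame_re (z j u) u @[u --> 0^'+] --> frame_re (z j 0) 0 /\
  frame_im (z j u) u @[u --> 0^'+] --> frame_im (z j 0) 0.
Proof.
move=> tau0 sol j; have [/continuous_within_itvcyP[cz _] _] := sol j.
have {}cz : toR2 (z j u) @[u --> 0^'+] --> toR2 (z j 0).
  apply: cvg_at_right_filter; apply: cz.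
  by rewrite in_itv /= oppr_lt0 tau0.
have cx : x j u @[u --> 0^'+] --> x j 0 := cvg_comp _ fst cz cvg_fst.
have cy : y j u @[u --> 0^'+] --> y j 0 := cvg_comp _ snd cz cvg_snd.
have cangle : angle u @[u --> 0^'+] --> angle 0.
  apply: cvg_at_right_filter; apply: cvgM; first exact: cvg_cst.
  by apply: cvgD; [exact: cvg_id|exact: cvg_cst].
have cc : cos (angle u) @[u --> 0^'+] --> cos (angle 0).
  exact: (cvg_comp _ _ cangle (@continuous_cos R _)).
have csn : sin (angle u) @[u --> 0^'+] --> sin (angle 0).
  exact: (cvg_comp _ _ cangle (@continuous_sin R _)).
split; apply: cvgM; try exact: cvg_cst.
  by apply: cvgD; (apply: cvgM; [first [exact: cx|exact: cy]|]).
by apply: cvgB; (apply: cvgM; [first [exact: cx|exact: cy]|]).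
Qed.

End Translation.

Lemma synchronous_orbit_solution (R : realType) (n : nat) (link : rel 'I_n)
    (h : R[i] -> R[i]) (alpha beta kappa tau : R) :
  0 < alpha -> h 0 = 0 ->
  network_solution link h alpha beta kappa tau (synchronous_orbit alpha beta).
Proof.
move=> alpha0 h0 j; set ra := Num.sqrt alpha.
have ra2 : ra ^+ 2 = alpha by rewrite sqr_sqrtr// ltW.
have dp (t : R) : is_derive t 1 (fun u => toR2 (synchronous_orbit alpha beta j u))
    (- (beta * (ra * sin (beta * t))), beta * (ra * cos (beta * t))).
  have dangle : is_derive t 1 (fun u => beta * u) beta.
    by apply: is_derive_eq; rewrite /GRing.scale /=; ring.
  have dcos : is_derive t 1 (fun u => cos (beta * u)) (- sin (beta * t) * beta).
    by apply: is_derive1_comp.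
  have dsin : is_derive t 1 (fun u => sin (beta * u)) (cos (beta * t) * beta).
    by apply: is_derive1_comp.
  apply/is_derive_pairE; rewrite /toR2 /=; split.
    have -> : (fun u => ra * cos (beta * u) - 0 * sin (beta * u)) =
       (fun u => ra * cos (beta * u)) by apply/funext => u; ring.
    by apply: is_derive_eq; rewrite /GRing.scale /=; ring.
  have -> : (fun u => ra * sin (beta * u) + 0 * cos (beta * u)) =
     (fun u => ra * sin (beta * u)) by apply/funext => u; ring.
  by apply: is_derive_eq; rewrite /GRing.scale /=; ring.
split.
  apply: continuous_subspaceT => t.
  by apply/differentiable_continuous/derivable1_diffP; have [] := dp t.
move=> t _; apply: (is_derive_eq (dp t)).
rewrite /vector_field big1 => [|l _]; last by rewrite subrr h0 mulr0.
rewrite mulr0 addr0 -add_Re2_Im2 /synchronous_orbit -/ra /toR2 /=.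
have cs : ra * cos (beta * t) * (ra * cos (beta * t)) +
   ra * sin (beta * t) * (ra * sin (beta * t)) = alpha.
  transitivity (ra ^+ 2 * (cos (beta * t) ^+ 2 + sin (beta * t) ^+ 2)).
    by ring.
  by rewrite cos2Dsin2 mulr1.
congr (_, _); rewrite ?mul0r ?subr0 ?addr0 ?expr2 ?cs; ring.
Qed.

Lemma weak_coupling_stability (R : realType) (n : nat) (link : rel 'I_n)
    (h : R[i] -> R[i]) (alpha beta tau : R) :
  0 < alpha -> beta != 0 -> 0 < tau -> connected_network link ->
  diagonalizable (laplacian R[i] link) -> coupling_function h ->
  exists2 kc : R, 0 < kc & forall kappa : R,
    `|kappa| < kc -> 0 < kappa * cos (beta * tau) ->
    orbitally_exponentially_stable link h alpha beta kappa tau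
      (synchronous_orbit alpha beta).
Proof.
move=> alpha0 beta0 tau0 connected diag hc.
(* If the cosine vanishes, no [kappa] satisfies the sign condition and any [kc] will do. *)
have [cos0|cos0] := eqVneq (cos (beta * tau)) 0.
  by exists 1 => // kappa _; rewrite cos0 mulr0 ltxx.
have cos1 : `|cos (beta * tau)| <= 1 by rewrite ler_norml cos_geN1 cos_le1.
have sin1 : `|sin (beta * tau)| <= 1 by rewrite ler_norml sin_geN1 sin_le1.
have [kc [eps [kc0 eps0 stab]]] :=
  rotating_frame_stability connected diag alpha0 tau0 cos0 cos1 sin1.
have [r r0 lin] := coupling_linearization hc (divr_gt0 eps0 (ltr0n _ 4)).
pose ra := Num.sqrt alpha; have ra0 : 0 < ra by rewrite sqrtr_gt0.
exists kc => // kappa k_lt k_cos.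
have [|delta [C [rate [delta0 C0 rate0 frame_stab]]]] :=
  stab kappa (r / (2 * ra)) k_lt k_cos; first by rewrite divr_gt0// mulr_gt0.
split; first by apply: synchronous_orbit_solution => //; have [] := hc.
(* A perturbation of size [e] becomes [2 * e / ra] in the frame, and returning multiplies by
   [4 * ra]. *)
exists (delta * ra / 2), (8 * C), rate; split => //.
- by rewrite divr_gt0// mulr_gt0.
- by rewrite mulr_gt0.
move=> z s e sol /andP[e0 e_delta] hist.
have [] := frame_stab _ _ _ _ (2 * e / ra)
  (frame_network_solution s alpha0 sol)
  (frame_coupling_estimate alpha0 lin).
- by rewrite divr_gt0 ?mulr_gt0//= ler_pdivrMr//; move: e_delta; lra.
- by move=> j; have [] := frame_right_continuous s tau0 sol j.
- by move=> j; have [] := frame_right_continuous s tau0 sol j.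
- by move=> j t tI; exact: (frame_of_near_orbit alpha0 beta0 (hist j t tI)).
move=> psi lim; exists (s + psi / beta) => j t t0; have [da db] := lim j t t0.
apply: le_trans (near_orbit_of_frame alpha0 j beta0 da db) _.
rewrite le_eqVlt; apply/orP; left; apply/eqP; rewrite -/ra.
by field; exact: lt0r_neq0.
Qed.

Theorem theorem3p2 (R : realType) (n : nat) (link : rel 'I_n)
    (h : R[i] -> R[i]) (alpha beta : R)
    (alpha_gt0 : 0 < alpha) (beta_gt0 : 0 < beta)
    (link_connected : connected_network link)
    (laplacian_diag : diagonalizable (laplacian R[i] link))
    (h_coupling : coupling_function h)
    (bounded : forall kappa tau : R, 0 < tau ->
       uniformly_bounded_solutions link h alpha beta kappa tau) :
  exists (tau0 : R) (kappac : R -> R),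
    [/\ 0 < tau0,
        forall tau : R, tau0 < tau ->
          (forall M : nat, tau <> (pi + 2 * M%:R * pi) / (2 * beta)) ->
          [/\ 0 < kappac tau,
              0 < cos (beta * tau) ->
                forall kappa : R, 0 < kappa < kappac tau ->
                orbitally_exponentially_stable link h alpha beta kappa tau
                  (synchronous_orbit alpha beta)
            & cos (beta * tau) < 0 ->
                forall kappa : R, - kappac tau < kappa < 0 ->
                orbitally_exponentially_stable link h alpha beta kappa tau
                  (synchronous_orbit alpha beta)]
      & kappac tau @[tau --> +oo] --> (0 : R)].
Proof.
(* The condition [0 < tau] sits inside the existential so that choice yields a function on all of
   [R]; for other [tau] its value is arbitrary. *)
have stab (tau : R) : exists k : R, 0 < k /\ (0 < tau -> forall kappa : R,
    `|kappa| < k -> 0 < kappa * cos (beta * tau) ->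
    orbitally_exponentially_stable link h alpha beta kappa tau
      (synchronous_orbit alpha beta)).
  have [tau0|tau0] := ltP 0 tau; last by exists 1.
  have [k k0 Hk] := weak_coupling_stability alpha_gt0 (lt0r_neq0 beta_gt0) tau0
    link_connected laplacian_diag h_coupling.
  by exists k.
have [k Hk] := choice stab.
(* Shrinking the coupling range preserves stability, and the bound [tau^-1] forces the limit 0. *)
exists 1, (fun tau => Num.min (k tau) tau^-1); split => //.
  move=> tau tau1 _; have tau0 : 0 < tau by exact: lt_trans tau1.
  have [k0 stable] := Hk tau.
  split; first by rewrite lt_min k0 invr_gt0.
    move=> cos0 kappa /andP[kappa0]; rewrite lt_min => /andP[kk _].
    by apply: stable => //; [rewrite gtr0_norm//|exact: mulr_gt0].
  move=> cos0 kappa /andP[+ kappa0]; rewrite ltrNl lt_min => /andP[kk _].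
  by apply: stable => //; [rewrite ltr0_norm//|rewrite nmulr_rgt0//].
apply/cvgrPdist_le => e e0; near=> tau.
have tau_e : e^-1 < tau by near: tau; apply: nbhs_pinfty_gt; exact: num_real.
have tau0 : 0 < tau by apply: lt_trans tau_e; rewrite invr_gt0.
rewrite sub0r normrN ger0_norm; last first.
  by rewrite le_min invr_ge0 !ltW//; have [] := Hk tau.
rewrite ge_min; apply/orP; right.
by rewrite -[e]invrK lef_pV2 ?posrE ?invr_gt0// ltW.
Unshelve. all: by end_near. Qed.
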